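(* Let $a_1,b_1,a_2,b_2,a_3,b_3$ be real numbers with $0\le a_i<b_i$ for $i=1,2,3$ and $$a_1b_2b_3+b_1a_2a_3 \;\le\; b_1a_2b_3+a_1b_2a_3 \;\le\; b_1b_2a_3+a_1a_2b_3 .$$ Let $\mathcal{P}_3\subset\mathbb{R}^4$ be the double-McCormick relaxation obtained by first grouping $x_1$ and $x_2$, let $\mathcal{P}_H\subset\mathbb{R}^4$ be the trilinear hull, and let $v^1,\dots,v^8,v_3^9,\dots,v_3^{12}\in\mathbb{R}^4$ be the points defined in the context. Then the set of extreme points of $\mathcal{P}_3$ is $\{v^1,\ldots,v^8\}\cup\{v_3^9,v_3^{10},v_3^{11},v_3^{12}\}$. Moreover, $$\operatorname{Vol}(\mathcal{P}_3)=\operatorname{Vol}(\mathcal{P}_H)+\frac{(b_1-a_1)(b_2-a_2)^2(b_3-a_3)^2\big(5(a_1b_1b_2-a_1b_1a_2)+3(b_1^2a_2-a_1^2b_2)\big)}{24(b_1b_2-a_1a_2)}.$$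
   Context: Points of $\mathbb{R}^4$ are written with coordinates $(f,x_1,x_2,x_3)$; $\operatorname{Vol}$ is 4-dimensional Lebesgue measure. Trilinear hull: $\mathcal{P}_H$ is the convex hull of the eight points $(x_1x_2x_3,x_1,x_2,x_3)$ with $x_i\in\{a_i,b_i\}$, $i=1,2,3$. Double-McCormick relaxation: $\mathcal{P}_3$ is the set of all $(f,x_1,x_2,x_3)\in\mathbb{R}^4$ for which there exists $w\in\mathbb{R}$ satisfying the McCormick inequalities for $w=x_1x_2$, $$w-a_2x_1-a_1x_2+a_1a_2\ge0,\quad -w+b_2x_1+a_1x_2-a_1b_2\ge0,\quad -w+a_2x_1+b_1x_2-b_1a_2\ge0,\quad w-b_2x_1-b_1x_2+b_1b_2\ge0,$$ and the McCormick inequalities for $f=wx_3$ with $w\in[a_1a_2,b_1b_2]$, $$f-a_3w-a_1a_2x_3+a_1a_2a_3\ge0,\quad -f+b_3w+a_1a_2x_3-a_1a_2b_3\ge0,\quad -f+a_3w+b_1b_2x_3-b_1b_2a_3\ge0,\quad f-b_3w-b_1b_2x_3+b_1b_2b_3\ge0.$$ Points: $v^1=(b_1a_2a_3,b_1,a_2,a_3)$, $v^2=(a_1a_2a_3,a_1,a_2,a_3)$, $v^3=(a_1a_2b_3,a_1,a_2,b_3)$, $v^4=(a_1b_2a_3,a_1,b_2,a_3)$, $v^5=(a_1b_2b_3,a_1,b_2,b_3)$, $v^6=(b_1b_2b_3,b_1,b_2,b_3)$, $v^7=(b_1b_2a_3,b_1,b_2,a_3)$, $v^8=(b_1a_2b_3,b_1,a_2,b_3)$,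 and $$v_3^9=(\theta^3,b_1,a_2,\theta^4),\quad v_3^{10}=(\theta^1,a_1,b_2,\theta^2),\quad v_3^{11}=(\theta^7,a_1,b_2,\theta^8),\quad v_3^{12}=(\theta^5,b_1,a_2,\theta^6),$$ where, with $D=b_1b_2-a_1a_2$, $$\theta^1=a_1a_2a_3+\tfrac{a_1(b_2-a_2)(b_1b_2b_3-a_1a_2a_3)}{D},\quad \theta^2=a_3+\tfrac{a_1(b_3-a_3)(b_2-a_2)}{D},$$ $$\theta^3=a_1a_2a_3+\tfrac{a_2(b_1-a_1)(b_1b_2b_3-a_1a_2a_3)}{D},\quad \theta^4=a_3+\tfrac{a_2(b_1-a_1)(b_3-a_3)}{D},$$ $$\theta^5=\tfrac{b_1a_2(a_3b_1b_2-a_3a_1b_2-b_3a_1a_2+b_3a_1b_2)}{D},\quad \theta^6=a_3+\tfrac{b_1(b_3-a_3)(b_2-a_2)}{D},$$ $$\theta^7=\tfrac{a_1b_2(b_3b_1a_2-b_3a_1a_2-a_3b_1a_2+a_3b_1b_2)}{D},\quad \theta^8=a_3+\tfrac{b_2(b_1-a_1)(b_3-a_3)}{D}.$$ (When some $a_i=0$ some of the listed points may coincide; the statement concerns the set of points.) *)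

(* Defs.v *)
From HB Require Import structures.
From mathcomp Require Import all_boot all_order all_algebra.
From mathcomp Require Import all_classical all_reals all_analysis.

Set Implicit Arguments.
Unset Strict Implicit.
Unset Printing Implicit Defensive.

Import Order.TTheory GRing.Theory Num.Theory.
Import numFieldNormedType.Exports.

Local Open Scope classical_set_scope.
Local Open Scope ring_scope.
Local Open Scope convex_scope.

Definition convex_hull (R : realType) (M : lmodType R)
    (S : set (convex_lmodType M)) : set (convex_lmodType M) :=
  smallest (@convex_set R M) S.

Definition extreme_points (R : realType) (M : lmodType R)
    (A : set (convex_lmodType M)) : set (convex_lmodType M) :=
  [set p | A p /\ forall (x y : convex_lmodType M) (t : {i01 R}),
     A x -> A y -> 0 < t%:num < 1 -> p = x <| t |> y -> x = p /\ y = p].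

(* A point (f, x1, x2, x3) is the left-nested tuple (((f, x1), x2), x3); the
   copies R^o of R make R4 R the product vector space over R. *)
Definition R4 (R : realType) : lmodType R := (R^o * R^o * R^o * R^o)%type.

(* Only meaningful on Borel sets, such as the closed sets PH and P3 below. *)
Definition Vol (R : realType) : set (R4 R) -> \bar R :=
  (lebesgue_measure \x lebesgue_measure \x lebesgue_measure
     \x lebesgue_measure)%E : set (R * R * R * R) -> \bar R.

Section trilinear.
Variables (R : realType) (a1 b1 a2 b2 a3 b3 : R).

Definition PH : set (R4 R) :=
  convex_hull [set p : R4 R | exists x1 x2 x3 : R,
    [/\ x1 = a1 \/ x1 = b1, x2 = a2 \/ x2 = b2, x3 = a3 \/ x3 = b3 &
        p = (x1 * x2 * x3, x1, x2, x3)]].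

(* The first four inequalities are the McCormick inequalities of w = x1 * x2
   over [a1, b1] x [a2, b2]; the last four are those of f = w * x3 over
   [a1 * a2, b1 * b2] x [a3, b3]. *)
Definition P3 : set (R4 R) :=
  [set p : R4 R | let: (f, x1, x2, x3) := p in exists w : R,
    [/\ 0 <= w - a2 * x1 - a1 * x2 + a1 * a2,
        0 <= - w + b2 * x1 + a1 * x2 - a1 * b2,
        0 <= - w + a2 * x1 + b1 * x2 - b1 * a2 &
        0 <= w - b2 * x1 - b1 * x2 + b1 * b2] /\
    [/\ 0 <= f - a3 * w - a1 * a2 * x3 + a1 * a2 * a3,
        0 <= - f + b3 * w + a1 * a2 * x3 - a1 * a2 * b3,
        0 <= - f + a3 * w + b1 * b2 * x3 - b1 * b2 * a3 &
        0 <= f - b3 * w - b1 * b2 * x3 + b1 * b2 * b3]].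

Definition P3_vertices : set (R4 R) :=
  let D := b1 * b2 - a1 * a2 in
  let theta1 :=
    a1 * a2 * a3 + a1 * (b2 - a2) * (b1 * b2 * b3 - a1 * a2 * a3) / D in
  let theta2 := a3 + a1 * (b3 - a3) * (b2 - a2) / D in
  let theta3 :=
    a1 * a2 * a3 + a2 * (b1 - a1) * (b1 * b2 * b3 - a1 * a2 * a3) / D in
  let theta4 := a3 + a2 * (b1 - a1) * (b3 - a3) / D in
  let theta5 :=
    b1 * a2 * (a3 * b1 * b2 - a3 * a1 * b2 - b3 * a1 * a2 + b3 * a1 * b2)
      / D in
  let theta6 := a3 + b1 * (b3 - a3) * (b2 - a2) / D in
  let theta7 :=
    a1 * b2 * (b3 * b1 * a2 - b3 * a1 * a2 - a3 * b1 * a2 + a3 * b1 * b2)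
      / D in
  let theta8 := a3 + b2 * (b1 - a1) * (b3 - a3) / D in
  [set (b1 * a2 * a3, b1, a2, a3);
       (a1 * a2 * a3, a1, a2, a3);
       (a1 * a2 * b3, a1, a2, b3);
       (a1 * b2 * a3, a1, b2, a3);
       (a1 * b2 * b3, a1, b2, b3);
       (b1 * b2 * b3, b1, b2, b3);
       (b1 * b2 * a3, b1, b2, a3);
       (b1 * a2 * b3, b1, a2, b3)] `|`
  [set (theta3, b1, a2, theta4);
       (theta1, a1, b2, theta2);
       (theta7, a1, b2, theta8);
       (theta5, b1, a2, theta6)].

End trilinear.

(* Main.v *)
Require Import Defs.
From HB Require Import structures.
From mathcomp Require Import all_boot all_order all_algebra.
From mathcomp Require Import all_classical all_reals all_analysis.
From mathcomp Require Import measurable_realfun.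
From mathcomp Require Import ring lra.
Set Implicit Arguments.
Unset Strict Implicit.
Unset Printing Implicit Defensive.
Import Order.TTheory GRing.Theory Num.Theory.
Import numFieldNormedType.Exports.
Local Open Scope classical_set_scope.
Local Open Scope ring_scope.

(* Write x_i = a_i + d_i p_i with d_i = b_i - a_i and (p_1, p_2, p_3) = (p, q, r)
   in the unit cube, and D = b1 b2 - a1 a2.

   Extreme points. Both McCormick systems cut out tetrahedra, in (x1, x2, w) and
   in (f, w, x3). Gluing barycentric coordinates along w writes every point of P3
   as a convex combination of points over the corners of the square in (p, q),
   where w is determined; over such a corner P3 is a parallelogram in (f, x3).
   This gives sixteen points, which are the twelve listed ones with repetitions.
   Each of them is extreme because enough of the defining inequalities are tight.

   Volumes. Both polytopes are regions lo <= f <= hi over the box. For P3 the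
   bounds follow from the monotonicity of the second system in w. For PH the
   upper bound is linear on the Kuhn triangulation of the cube; the lower bound
   is linear on two corner simplices and on a central octahedron split into four
   around one diagonal, which the ordering hypothesis selects. All the bounds are
   polynomials in p, q, r and in positive parts of affine functions, so hi - lo
   can be integrated one variable at a time, first in x3, then x1, then x2. *)

(** * Iterated integrals and the volume between two graphs *)

(** Integrating the sections in either order gives a measure with the right values on rectangles;
    uniqueness of the product measure identifies the two. *)
Lemma product_measure_ysection d1 d2 (T1 : measurableType d1)
    (T2 : measurableType d2) (R : realType)
    (m1 : {sigma_finite_measure set T1 -> \bar R})
    (m2 : {sigma_finite_measure set T2 -> \bar R}) (A : set (T1 * T2)) :
  measurable A -> ((m1 \x m2) A = \int[m2]_y m1 (ysection A y))%E.
Proof.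
move=> mA; rewrite (@product_measure_unique _ _ _ _ _ _ _ (m1 \x^ m2)%E)//.
by move=> B C mB mC; exact: product_measure2E.
Qed.

(* Type inference does not find that [m1 \x m2] is sigma-finite, which is needed
   to iterate [product_measure_ysection]; hence this alias. *)
Section sigma_finite_product.
Context d1 d2 (T1 : measurableType d1) (T2 : measurableType d2) (R : realType).
Variables (m1 : {sigma_finite_measure set T1 -> \bar R})
  (m2 : {sigma_finite_measure set T2 -> \bar R}).

Definition product_sigma_finite : set (T1 * T2) -> \bar R := (m1 \x m2)%E.

Let product_sigma_finite0 : product_sigma_finite set0 = 0%E.
Proof. exact: measure0. Qed.

Let product_sigma_finite_ge0 A : (0 <= product_sigma_finite A)%E.
Proof. exact: measure_ge0. Qed.

Let product_sigma_finite_additive : semi_sigma_additive product_sigma_finite.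
Proof. exact: measure_semi_sigma_additive. Qed.

HB.instance Definition _ := isMeasure.Build _ _ _ product_sigma_finite
  product_sigma_finite0 product_sigma_finite_ge0 product_sigma_finite_additive.

Let product_sigma_finiteT : sigma_finite setT product_sigma_finite.
Proof.
have /sigma_finiteP[F [TF ndF Ffin]] := sigma_finiteT m1.
have /sigma_finiteP[G [TG ndG Gfin]] := sigma_finiteT m2.
(* Both exhaustions increase, so a point of [F i] times [G j] lies in the rectangle of index
   [maxn i j]. *)
exists (fun n => F n `*` G n) => [|n].
  apply/seteqP; split=> // -[x y] _.
  have [i _ Fx] : (\bigcup_k F k) x by rewrite -TF.
  have [j _ Gy] : (\bigcup_k G k) y by rewrite -TG.
  exists (maxn i j) => //; split.
    by move: x Fx; exact/subsetPset/ndF/leq_maxl.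
  by move: y Gy; exact/subsetPset/ndG/leq_maxr.
have [mF Fy] := Ffin n; have [mG Gy] := Gfin n.
split; first exact: measurableX.
rewrite /product_sigma_finite product_measure1E//.
by rewrite lte_mul_pinfty// ge0_fin_numE.
Qed.

HB.instance Definition _ := Measure_isSigmaFinite.Build _ _ _
  product_sigma_finite product_sigma_finiteT.

End sigma_finite_product.

Section iterated_integrals.
Context d1 d2 d3 d4 (T1 : measurableType d1) (T2 : measurableType d2)
  (T3 : measurableType d3) (T4 : measurableType d4) (R : realType).
Variables (m1 : {sigma_finite_measure set T1 -> \bar R})
  (m2 : {sigma_finite_measure set T2 -> \bar R})
  (m3 : {sigma_finite_measure set T3 -> \bar R})
  (m4 : {sigma_finite_measure set T4 -> \bar R}).

Lemma product_measure4E (A : set (T1 * T2 * T3 * T4)) : measurable A ->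
  ((m1 \x m2 \x m3 \x m4) A =
   \int[m4]_x4 \int[m3]_x3 \int[m2]_x2 m1 [set x1 | A (x1, x2, x3, x4)])%E.
Proof.
move=> mA.
pose m12 := product_sigma_finite m1 m2.
pose m123 := product_sigma_finite m12 m3.
have mA4 x4 := measurable_ysection x4 mA.
have mA3 x4 x3 := measurable_ysection x3 (mA4 x4).
transitivity (\int[m4]_x4 m123 (ysection A x4))%E.
  exact: (@product_measure_ysection _ _ _ _ _ m123 m4 A mA).
apply: eq_integral => x4 _.
transitivity (\int[m3]_x3 m12 (ysection (ysection A x4) x3))%E.
  exact: (@product_measure_ysection _ _ _ _ _ m12 m3 _ (mA4 x4)).
apply: eq_integral => x3 _.
apply: (etrans (@product_measure_ysection _ _ _ _ _ m1 m2 _ (mA3 x4 x3))).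
apply: eq_integral => x2 _; congr (m1 _).
by apply/seteqP; split=> x1; rewrite /ysection/= ?inE/= ?inE/= ?inE.
Qed.

(** Two uses of Tonelli move the variable [z] inwards, past [y] and then past [x], so that the last
    coordinate is integrated first. *)
Lemma integral_rotate (g : T2 -> T3 -> T4 -> \bar R) :
  (forall x y z, 0 <= g x y z)%E ->
  measurable_fun setT (fun x : T2 * T3 * T4 => g x.1.1 x.1.2 x.2) ->
  (\int[m4]_z \int[m3]_y \int[m2]_x g x y z =
   \int[m3]_y \int[m2]_x \int[m4]_z g x y z)%E.
Proof.
move=> g0 mg.
rewrite (fubini_tonelli (fun z : T4 * T3 => \int[m2]_x g x z.2 z.1)%E) /=; last 2 first.
- apply: (measurable_fun_fubini_tonelli_F (fun z : T4 * T3 * T2 => g z.2 z.1.2 z.1.1)) => //=.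
  have ms : measurable_fun setT (fun z : T4 * T3 * T2 => (z.2, z.1.2, z.1.1)).
    apply: measurable_fun_pair; last exact: (measurableT_comp measurable_fst).
    apply: measurable_fun_pair; first exact: measurable_snd.
    exact: (measurableT_comp measurable_snd).
  exact: (measurableT_comp mg ms).
- by move=> z; apply: integral_ge0 => x _; exact: g0.
apply: eq_integral => y _.
rewrite (fubini_tonelli (fun z : T4 * T2 => g z.2 y z.1)) //=.
have ms : measurable_fun setT (fun z : T4 * T2 => (z.2, y, z.1)).
  apply: measurable_fun_pair; last exact: measurable_fst.
  by apply: measurable_fun_pair; first exact: measurable_snd.
exact: (measurableT_comp mg ms).
Qed.

End iterated_integrals.

Definition boxed_between (R : realType) (a1 b1 a2 b2 a3 b3 : R)
    (l u : R -> R -> R -> R) : set (R * R * R * R) :=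
  [set z | [&& a1 <= z.1.1.2 <= b1, a2 <= z.1.2 <= b2, a3 <= z.2 <= b3 &
        l z.1.1.2 z.1.2 z.2 <= z.1.1.1 <= u z.1.1.2 z.1.2 z.2]].

Lemma lebesgue_measure_cond_itv (R : realType) (P : bool) (a b : R) :
  (P -> a <= b) ->
  lebesgue_measure [set f : R | P && (a <= f <= b)] = (if P then b - a else 0)%:E.
Proof.
case: P => /= [/(_ erefl) ab|_]; last first.
  by rewrite (_ : [set _ | _] = set0) ?measure0//; apply/seteqP; split.
have -> : [set f : R | a <= f <= b] = `[a, b]%classic.
  by apply/seteqP; split => x /=; rewrite in_itv.
rewrite lebesgue_measure_itv /= lte_fin.
by case: ltP => // ba; rewrite (@le_anti _ _ a b) ?subrr// ab.
Qed.

Lemma Vol_between (R : realType) (a1 b1 a2 b2 a3 b3 : R) (l u : R -> R -> R -> R) :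
  measurable_fun setT (fun x : R * R * R => l x.1.1 x.1.2 x.2) ->
  measurable_fun setT (fun x : R * R * R => u x.1.1 x.1.2 x.2) ->
  (forall x1 x2 x3, a1 <= x1 <= b1 -> a2 <= x2 <= b2 -> a3 <= x3 <= b3 ->
    l x1 x2 x3 <= u x1 x2 x3) ->
  (Vol (boxed_between a1 b1 a2 b2 a3 b3 l u) =
  \int[lebesgue_measure]_(x2 in `[a2, b2]) \int[lebesgue_measure]_(x1 in `[a1, b1])
    \int[lebesgue_measure]_(x3 in `[a3, b3]) (u x1 x2 x3 - l x1 x2 x3)%:E)%E.
Proof.
move=> ml mu lu.
pose A4 := boxed_between a1 b1 a2 b2 a3 b3 l u.
have m11 : measurable_fun setT (fun z : R * R * R * R => z.1.1.1).
  exact/(measurableT_comp measurable_fst)/(measurableT_comp measurable_fst).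
have m12 : measurable_fun setT (fun z : R * R * R * R => z.1.1.2).
  exact/(measurableT_comp measurable_snd)/(measurableT_comp measurable_fst).
have m2 : measurable_fun setT (fun z : R * R * R * R => z.1.2).
  exact: (measurableT_comp measurable_snd).
have drop_f : measurable_fun setT (fun z : R * R * R * R => (z.1.1.2, z.1.2, z.2)).
  by apply: measurable_fun_pair => //; exact: measurable_fun_pair.
have ml' := measurableT_comp ml drop_f.
have mu' := measurableT_comp mu drop_f.
have itv_bool d (T : measurableType d) (p q r : T -> R) : measurable_fun setT p ->
    measurable_fun setT q -> measurable_fun setT r ->
    measurable_fun setT (fun x => p x <= q x <= r x).
  by move=> mp mq mr; apply: measurable_and; exact: measurable_fun_ler.
have mA4 : measurable (A4 : set (R * R * R * R)).
  rewrite -[A4]setTI /A4 /boxed_between -preimage_true.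
  have mb : measurable_fun setT (fun z : R * R * R * R =>
      [&& a1 <= z.1.1.2 <= b1, a2 <= z.1.2 <= b2, a3 <= z.2 <= b3 &
        l z.1.1.2 z.1.2 z.2 <= z.1.1.1 <= u z.1.1.2 z.1.2 z.2]).
    apply: measurable_and; first exact: itv_bool.
    apply: measurable_and; first exact: itv_bool.
    apply: measurable_and; first exact: itv_bool.
    exact: itv_bool.
  exact: (mb measurableT [set true]).
(* The fiber length is extended by zero outside the box, so that all integrals run over the whole
   line while their order is changed. *)
pose box (x1 x2 x3 : R) := [&& a1 <= x1 <= b1, a2 <= x2 <= b2 & a3 <= x3 <= b3].
pose g (x1 x2 x3 : R) :=
  (if box x1 x2 x3 then u x1 x2 x3 - l x1 x2 x3 else 0).
have mg : measurable_fun setT (fun x : R * R * R => (g x.1.1 x.1.2 x.2)%:E).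
  apply/measurable_EFinP; apply: measurable_fun_ifT => //; last first.
    exact: measurable_funB.
  rewrite /box; apply: measurable_and.
    by apply: itv_bool => //; exact: (measurableT_comp measurable_fst).
  apply: measurable_and; last exact: itv_bool.
  by apply: itv_bool => //; exact: (measurableT_comp measurable_snd).
have g0 x1 x2 x3 : (0 <= (g x1 x2 x3)%:E)%E.
  by rewrite lee_fin /g; case: ifP => // /and3P[? ? ?]; rewrite subr_ge0 lu.
transitivity (\int[lebesgue_measure]_x3 \int[lebesgue_measure]_x2
   \int[lebesgue_measure]_x1 (g x1 x2 x3)%:E)%E.
  have -> : Vol A4 = (\int[lebesgue_measure]_x3 \int[lebesgue_measure]_x2
   \int[lebesgue_measure]_x1 lebesgue_measure [set f : R | A4 (f, x1, x2, x3)])%E.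
    exact: product_measure4E.
  apply: eq_integral => x3 _; apply: eq_integral => x2 _; apply: eq_integral => x1 _.
  rewrite -lebesgue_measure_cond_itv; last by move=> /and3P[? ? ?]; exact: lu.
  congr (lebesgue_measure _); apply/seteqP.
  by split=> f /=; rewrite /A4 /boxed_between/= /box -!andbA.
have rot := integral_rotate (@lebesgue_measure R) (@lebesgue_measure R)
  (@lebesgue_measure R) g0 mg.
apply: (etrans rot) => {rot} /=.
(* Back to integrals over intervals, one variable at a time: outside its interval the integrand
   vanishes. *)
rewrite [RHS]integral_mkcond; apply: eq_integral => x2 _.
rewrite patchE; case: ifPn => [|]; rewrite mem_setE in_itv/= => hx2; last first.
  rewrite integral0_eq// => x1 _; rewrite integral0_eq// => x3 _.
  by rewrite /g /box (negbTE hx2) andbF.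
rewrite [RHS]integral_mkcond; apply: eq_integral => x1 _.
rewrite patchE; case: ifPn => [|]; rewrite mem_setE in_itv/= => hx1; last first.
  by rewrite integral0_eq// => x3 _; rewrite /g /box (negbTE hx1).
rewrite [RHS]integral_mkcond; apply: eq_integral => x3 _.
rewrite patchE; case: ifPn => [|]; rewrite mem_setE in_itv/= => hx3.
  by rewrite /g /box hx1 hx2 hx3.
by rewrite /g /box (negbTE hx3) !andbF.
Qed.

(** * Integrals of piecewise polynomials over the unit interval *)

Section primitives.
Context {R : realType}.
Implicit Types (f g F : R -> R) (x c v w : R).

(** Serves for the square of a positive part, which is differentiable although the positive part has
    a kink: the bound makes the difference quotient err by at most [k * |h|]. *)
Lemma is_derive_quadratic_error F x l k :
  0 < k -> (forall h, `|F (x + h) - F x - h * l| <= k * h ^+ 2) -> is_derive x 1 F l.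
Proof.
move=> k0 Fl.
have FE : h^-1 *: (F (h *: 1 + x) - F x) @[h --> 0^'] --> l.
  apply/cvgrPdist_le => /= e e0; near=> h.
  have h0 : h != 0 by near: h; exact: nbhs_dnbhs_neq.
  have -> : l - h^-1 *: (F (h *: 1 + x) - F x) = - (h^-1 * (F (x + h) - F x - h * l)).
    by rewrite /GRing.scale/= mulr1 [h + x]addrC; field.
  rewrite normrN normrM normfV ler_pdivrMl ?normr_gt0//.
  apply: (le_trans (Fl h)).
  rewrite -real_normK ?num_real// expr2 mulrCA ler_wpM2l//.
  rewrite -ler_pdivlMl// ltW//.
  by near: h; apply: dnbhs0_lt; rewrite mulr_gt0// invr_gt0.
apply: DeriveDef; first by apply/cvg_ex; exists l.
by rewrite /derive; apply/cvg_lim.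
Unshelve. all: by end_near. Qed.

Definition pos x := Num.max 0 x.

Lemma is_derive_pos_sqr c x :
  is_derive x 1 (fun t => pos (t - c) ^+ 2) (2 * pos (x - c)).
Proof.
apply: (@is_derive_quadratic_error _ _ _ 1) => // h.
have -> : x + h - c = (x - c) + h by ring.
rewrite /pos mul1r ler_norml; move: (x - c) => t.
have [ht|ht] := leP 0 t; have [hth|hth] := leP 0 (t + h); nra.
Qed.

(** The cube is [t - c] times the square, so the product rule applies. *)
Lemma is_derive_pos_cube c x :
  is_derive x 1 (fun t => pos (t - c) ^+ 3) (3 * pos (x - c) ^+ 2).
Proof.
have posM t : (t - c) * pos (t - c) = pos (t - c) ^+ 2.
  by rewrite /pos; case: leP => _; rewrite ?mulr0 ?expr0n// expr2.
have dc : is_derive x 1 (fun t => t - c) 1.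
  by apply: is_derive_eq (is_deriveB _ _) _; last exact: subr0.
have -> : (fun t => pos (t - c) ^+ 3) = (fun t => t - c) * (fun t => pos (t - c) ^+ 2).
  by apply/funext => t; rewrite fctE exprS -{1}posM; ring.
have ds := is_derive_pos_sqr c x.
apply: is_derive_eq; rewrite /GRing.scale/= -posM; ring.
Qed.

(** Integration over the unit interval is encoded by an explicit primitive, so that linear
    combinations need no integrability argument. *)
Definition integral01 f v := exists F,
  [/\ forall x, is_derive x 1 F (f x), continuous f & F 1 - F 0 = v].

(** The working form for computing integrals: a combination of basic integrands is proposed, and two
    algebraic identities remain, one for the integrand and one for the value. *)
Lemma integral01_ext f g v w :
  integral01 f v -> f =1 g -> v = w -> integral01 g w.
Proof. by move=> fv /funext <- <-. Qed.

Lemma integral01D f g v w : integral01 f v -> integral01 g w ->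
  integral01 (fun x => f x + g x) (v + w).
Proof.
move=> [F [dF cf <-]] [G [dG cg <-]]; exists (F + G); split => [x|x|].
- exact: is_deriveD.
- exact: (cvgD (cf x) (cg x)).
- by rewrite !fctE; ring.
Qed.

Lemma integral01Z k f v : integral01 f v -> integral01 (fun x => k * f x) (k * v).
Proof.
move=> [F [dF cf <-]]; exists (k \*: F); split => [x|x|].
- exact: is_deriveZ.
- exact: (cvgM (cvg_cst k) (cf x)).
- by rewrite /GRing.scale/= mulrBr.
Qed.

Lemma integral01_monomial n : integral01 (fun x => x ^+ n) n.+1%:R^-1.
Proof.
have n0 : n.+1%:R != 0 :> R by rewrite pnatr_eq0.
exists (n.+1%:R^-1 \*: (id ^+ n.+1)); split => [x|x|].
- apply: is_derive_eq; rewrite /GRing.scale/= mulr1 mulrA mulVf// mul1r//.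
- exact: exprn_continuous.
- by rewrite !fctE/= expr1n expr0n/= scaler0 subr0 /GRing.scale/= mulr1.
Qed.

Lemma integral01_cubic (c0 c1 c2 c3 : R) :
  integral01 (fun x => c0 + c1 * x + c2 * x ^+ 2 + c3 * x ^+ 3)
    (c0 + c1 / 2 + c2 / 3 + c3 / 4).
Proof.
apply: (integral01_ext (integral01D (integral01D (integral01D
  (integral01Z c0 (integral01_monomial 0)) (integral01Z c1 (integral01_monomial 1)))
  (integral01Z c2 (integral01_monomial 2))) (integral01Z c3 (integral01_monomial 3)))).
  by move=> x /=; rewrite expr0 expr1 mulr1.
by rewrite invr1 mulr1.
Qed.

Lemma continuous_pos c : continuous (fun x => pos (x - c)).
Proof.
move=> x; apply: (@continuous_comp _ _ _ (fun x => x - c) pos).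
  by apply: cvgB; [exact: cvg_id|exact: cvg_cst].
by apply: continuous_max; [exact: cvg_cst|exact: cvg_id].
Qed.

Lemma integral01_pos c : integral01 (fun x => pos (x - c))
  ((pos (1 - c) ^+ 2 - pos (- c) ^+ 2) / 2).
Proof.
exists (2^-1 \*: (fun t => pos (t - c) ^+ 2)); split => [x|x|].
- have ds := is_derive_pos_sqr c x.
  by apply: is_derive_eq; rewrite /GRing.scale/= mulKf// pnatr_eq0.
- exact: continuous_pos.
- by rewrite /GRing.scale/= sub0r -mulrBr mulrC.
Qed.

Lemma integral01_pos_sqr c : integral01 (fun x => pos (x - c) ^+ 2)
  ((pos (1 - c) ^+ 3 - pos (- c) ^+ 3) / 3).
Proof.
exists (3^-1 \*: (fun t => pos (t - c) ^+ 3)); split => [x|x|].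
- have ds := is_derive_pos_cube c x.
  by apply: is_derive_eq; rewrite /GRing.scale/= mulKf// pnatr_eq0.
- apply: (@continuous_comp _ _ _ (fun x => pos (x - c)) (fun x => x ^+ 2)).
    exact: continuous_pos.
  exact: exprn_continuous.
- by rewrite /GRing.scale/= sub0r -mulrBr mulrC.
Qed.

(** Rescaling the primitive [F] to [(b - a) * F ((x - a) / (b - a))] gives a primitive on [[a, b]],
    to which the fundamental theorem of calculus applies. *)
Lemma integral_affine f v (a b : R) : a < b -> integral01 f v ->
  (\int[lebesgue_measure]_(x in `[a, b]) (f ((x - a) / (b - a)))%:E
   = ((b - a) * v)%:E)%E.
Proof.
move=> ab [F [dF cf <-]].
have d0 : b - a != 0 by rewrite subr_eq0 gt_eqF.
pose s x := (x - a) / (b - a).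
have ds x : is_derive x 1 s (b - a)^-1.
  rewrite /s; have -> : (fun x => (x - a) / (b - a)) = (b - a)^-1 \*: (id - cst a).
    by apply/funext => y; rewrite /GRing.scale/= !fctE mulrC.
  by apply: is_derive_eq; rewrite subr0 /GRing.scale/= mulr1.
pose G := (b - a) \*: (F \o s).
have dG x : is_derive x 1 G (f (s x)).
  have dFs := is_derive1_comp (dF (s x)) (ds x).
  by apply: is_derive_eq; rewrite /GRing.scale/=; field.
have cG : continuous G.
  by move=> x; apply/differentiable_continuous/derivable1_diffP; case: (dG x).
have cs : continuous s.
  by move=> x; apply/differentiable_continuous/derivable1_diffP; case: (ds x).
rewrite (@continuous_FTC2 _ (f \o s) G)//.
- by rewrite /G/= /s subrr mul0r divff// -EFinB /GRing.scale/= mulrBr.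
- by apply: continuous_subspaceT => x; apply: continuous_comp; [exact: cs|exact: cf].
- split => [x _||].
  + by case: (dG x).
  + exact/cvg_at_right_filter/cG.
  + exact/cvg_at_left_filter/cG.
- by move=> x _; rewrite derive1E; case: (dG x).
Qed.

End primitives.

(** * Convex combinations and extreme points *)

Section convex_combinations.
Local Open Scope convex_scope.
Context {R : realType} {M : lmodType R}.
Implicit Types (A S : set (convex_lmodType M)) (x y : M) (t : R)
  (s : seq (R * M)).

Lemma convex_setP A : convex_set A <->
  forall x y t, 0 <= t <= 1 -> A x -> A y -> A (t *: x + (1 - t) *: y).
Proof.
split=> [cA x y t /andP[t0 t1] Ax Ay|cA x y t].
  exact/set_mem/(cA x y (Itv01 t0 t1))/mem_set/Ay/mem_set.
by rewrite !inE => Ax Ay; apply: cA; rewrite ?ge0 ?le1.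
Qed.

(** Dividing by the total weight, instead of assuming it to be 1, lets the induction pass to the
    tail. *)
Lemma convex_sum_normalized A s : convex_set A ->
  (forall z, z \in s -> 0 <= z.1 /\ A z.2) ->
  let w := \sum_(z <- s) z.1 in 0 < w -> A (w^-1 *: \sum_(z <- s) z.1 *: z.2).
Proof.
move=> /convex_setP cA; elim: s => [|x s IHs] sA /=; first by rewrite big_nil ltxx.
have [x0 Ax] : 0 <= x.1 /\ A x.2 by apply: sA; rewrite mem_head.
have {sA}sA z : z \in s -> 0 <= z.1 /\ A z.2.
  by move=> zs; apply: sA; rewrite inE zs orbT.
rewrite !big_cons /=; set v := \sum_(j <- s) j.1; set p := \sum_(j <- s) _.
have v0 : 0 <= v by rewrite /v big_seq sumr_ge0// => z /sA[].
(* A tail of total weight 0 cannot be normalized, but then all its terms vanish. *)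
move=> w0; have [v_eq0|v_neq0] := eqVneq v 0.
  have -> : p = 0.
    rewrite /p big_seq big1// => z zs; apply/eqP; rewrite scaler_eq0.
    move/eqP: v_eq0; rewrite /v big_seq psumr_eq0; last by move=> i /sA[].
    by move=> /allP/(_ _ zs); rewrite zs /= => ->.
  move: w0; rewrite v_eq0 !addr0 => w0.
  by rewrite scalerA mulVf ?scale1r// gt_eqF.
have vp : 0 < v by rewrite lt_neqAle eq_sym v_neq0.
have w_neq0 : x.1 + v != 0 by rewrite gt_eqF.
have := cA _ _ (x.1 / (x.1 + v)) _ Ax (IHs sA vp).
rewrite -/v -/p; have -> : (1 - x.1 / (x.1 + v)) = (x.1 + v)^-1 * v by field.
rewrite scalerA mulfK// [x.1 / _]mulrC -scalerA -scalerDr; apply.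
by rewrite mulr_ge0 ?invr_ge0 ?(ltW w0)//= ler_pdivrMl ?mulr1 ?lerDl.
Qed.

Lemma convex_sum A s : convex_set A ->
  (forall z, z \in s -> 0 <= z.1 /\ A z.2) -> \sum_(z <- s) z.1 = 1 ->
  A (\sum_(z <- s) z.1 *: z.2).
Proof.
move=> cA sA s1; have := convex_sum_normalized cA sA.
by rewrite /= s1 invr1 scale1r; apply.
Qed.

(** A term of positive weight is split off and the others are merged into one normalized point [y];
    extremality of [p] on the segment from [x.2] to [y] forces [x.2 = p]. *)
Lemma extreme_points_sum A s (p : M) : convex_set A -> extreme_points A p ->
  (forall z, z \in s -> 0 <= z.1 /\ A z.2) -> \sum_(z <- s) z.1 = 1 ->
  p = \sum_(z <- s) z.1 *: z.2 -> exists2 z, z \in s & p = z.2.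
Proof.
move=> cA [Ap extp] sA s1 pE.
have [x xs x0] : exists2 z, z \in s & 0 < z.1.
  apply/hasP/negPn/negP => /hasPn s_le0.
  have : \sum_(z <- s) z.1 <= 0.
    by rewrite big_seq sumr_le0// => x /s_le0; rewrite -leNgt.
  by rewrite s1 ler10.
exists x => //; have [_ Ax] := sA _ xs.
have remA z : z \in rem x s -> 0 <= z.1 /\ A z.2 by move=> /mem_rem/sA.
move: s1 pE; rewrite (big_rem _ xs) [X in p = X](big_rem _ xs)/=.
set v := \sum_(j <- _) j.1 => s1.
have vE : v = 1 - x.1 by rewrite -s1 [RHS]addrC addKr.
have v0 : 0 <= v by rewrite /v big_seq sumr_ge0// => z /remA[].
have [v_eq0|v_neq0] := eqVneq v 0.
  rewrite big_seq big1 ?addr0 => [|z zs].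
    by move: s1; rewrite v_eq0 addr0 => ->; rewrite scale1r.
  apply/eqP; rewrite scaler_eq0.
  move/eqP: v_eq0; rewrite /v big_seq psumr_eq0; last by move=> i /remA[].
  by move=> /allP/(_ _ zs); rewrite zs /= => ->.
have vp : 0 < v by rewrite lt_neqAle eq_sym v_neq0.
have := convex_sum_normalized cA remA vp; rewrite /= -/v.
set y := v^-1 *: _ => Ay pE.
have x1 : x.1 <= 1 by rewrite -subr_ge0 -vE.
have [] // := extp x.2 y (Itv01 (ltW x0) x1) Ax Ay.
  by rewrite /= x0 -subr_gt0 -vE.
rewrite pE; transitivity (x.1 *: x.2 + (1 - x.1) *: y) => //.
by rewrite -vE /y scalerA divff// scale1r.
Qed.

Lemma sub_convex_hull S : S `<=` convex_hull S.
Proof. exact: sub_smallest. Qed.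

Lemma convex_convex_hull S : convex_set (convex_hull S).
Proof.
apply/convex_setP => x y t t01 Sx Sy A [cA SA].
have /convex_setP := cA; apply=> //.
  exact: (Sx A (conj cA SA)).
exact: (Sy A (conj cA SA)).
Qed.

Lemma convex_hull_sub S A : convex_set A -> S `<=` A -> convex_hull S `<=` A.
Proof. by move=> cA SA; exact: smallest_sub. Qed.

End convex_combinations.

(** * The extreme points of the double-McCormick relaxation *)

(** Applied with [u] and [v] the slacks of one inequality at the ends of a segment: an inequality
    tight inside the segment is tight at both ends. *)
Lemma convex_comb_eq0 (R : realType) (t u v : R) : 0 < t < 1 -> 0 <= u -> 0 <= v ->
  t * u + (1 - t) * v = 0 -> u = 0 /\ v = 0.
Proof.
move=> /andP[t0 t1] u0 v0 /eqP.
have t1' : 0 < 1 - t by rewrite subr_gt0.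
rewrite paddr_eq0 ?mulr_ge0 ?(ltW t0) ?(ltW t1')// !mulf_eq0 (gt_eqF t0) (gt_eqF t1')/=.
by move=> /andP[/eqP-> /eqP->].
Qed.

Section normalized.
Variables (R : realType) (a1 d1 a2 d2 a3 d3 : R).
Hypotheses (a1_ge0 : 0 <= a1) (a2_ge0 : 0 <= a2) (a3_ge0 : 0 <= a3).
Hypotheses (d1_gt0 : 0 < d1) (d2_gt0 : 0 < d2) (d3_gt0 : 0 < d3).
Local Notation b1 := (a1 + d1).
Local Notation b2 := (a2 + d2).
Local Notation b3 := (a3 + d3).
Local Notation D := (a1 * d2 + a2 * d1 + d1 * d2).
Implicit Types (f F p q r e g t W : R).

Let D_gt0 : 0 < D.
Proof. by rewrite ltr_wpDl ?mulr_gt0// addr_ge0 ?mulr_ge0 ?(ltW d1_gt0) ?(ltW d2_gt0). Qed.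

Definition pt f p q r : R4 R := (f, a1 + d1 * p, a2 + d2 * q, a3 + d3 * r).

Lemma pt_surj (z : R4 R) : exists f p q r, z = pt f p q r.
Proof.
case: z => [[[f x1] x2] x3].
exists f, ((x1 - a1) / d1), ((x2 - a2) / d2), ((x3 - a3) / d3).
by rewrite /pt; congr (_, _, _, _); field; rewrite gt_eqF.
Qed.

Lemma pt_comb t f p q r f' p' q' r' :
  t *: pt f p q r + (1 - t) *: pt f' p' q' r' =
  pt (t * f + (1 - t) * f') (t * p + (1 - t) * p') (t * q + (1 - t) * q')
    (t * r + (1 - t) * r').
Proof. by rewrite /pt; congr (_, _, _, _); rewrite /= /GRing.scale/=; ring. Qed.

(* The first McCormick relaxation, with [w = a1 * a2 + W]. *)
Definition mccormick12 p q W :=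
  [/\ a2 * d1 * p + a1 * d2 * q <= W, W <= b2 * d1 * p + a1 * d2 * q,
      W <= a2 * d1 * p + b1 * d2 * q &
      a2 * d1 * p + a1 * d2 * q + d1 * d2 * (p + q - 1) <= W].

(* The second one, with [f = a1 * a2 * x3 + F]. *)
Definition mccormick3 W r F :=
  [/\ a3 * W <= F, F <= b3 * W, F <= a3 * W + D * d3 * r &
      b3 * W + D * d3 * (r - 1) <= F].

Definition shifted_pt F p q r := pt (a1 * a2 * (a3 + d3 * r) + F) p q r.

Lemma shifted_pt_surj (z : R4 R) : exists F p q r, z = shifted_pt F p q r.
Proof.
have [f [p [q [r ->]]]] := pt_surj z.
by exists (f - a1 * a2 * (a3 + d3 * r)), p, q, r; rewrite /shifted_pt addrC subrK.
Qed.

Lemma shifted_pt_inj F p q r F' p' q' r' : shifted_pt F p q r = shifted_pt F' p' q' r' ->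
  [/\ F = F', p = p', q = q' & r = r'].
Proof.
have inj (a d x y : R) : 0 < d -> a + d * x = a + d * y -> x = y.
  by move=> d0 /addrI/mulfI; apply; rewrite gt_eqF.
case=> fE /(inj _ _ _ _ d1_gt0)-> /(inj _ _ _ _ d2_gt0)-> x3E.
by move: fE; rewrite x3E (inj _ _ _ _ d3_gt0 x3E) => /addrI->.
Qed.

Lemma P3_shifted_pt F p q r : P3 a1 b1 a2 b2 a3 b3 (shifted_pt F p q r) <->
  exists W, mccormick12 p q W /\ mccormick3 W r F.
Proof.
rewrite /P3 /shifted_pt /pt /=; split=> [[w]|[W]] [[A1 A2 A3 A4] [A5 A6 A7 A8]].
  by exists (w - a1 * a2); split; split; lra.
by exists (a1 * a2 + W); split; split; lra.
Qed.

Lemma shifted_pt_comb t F p q r F' p' q' r' :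
  t *: shifted_pt F p q r + (1 - t) *: shifted_pt F' p' q' r' =
  shifted_pt (t * F + (1 - t) * F') (t * p + (1 - t) * p') (t * q + (1 - t) * q')
    (t * r + (1 - t) * r').
Proof. by rewrite /shifted_pt pt_comb; congr (pt _ _ _ _); ring. Qed.

Lemma convex_P3 : convex_set (P3 a1 b1 a2 b2 a3 b3).
Proof.
apply/convex_setP => x y t /andP[t0 t1].
have t1' : 0 <= 1 - t by rewrite subr_ge0.
have [F [p [q [r ->]]]] := shifted_pt_surj x; have [F' [p' [q' [r' ->]]]] := shifted_pt_surj y.
have comb (u v u' v' : R) : u <= v -> u' <= v' ->
    t * u + (1 - t) * u' <= t * v + (1 - t) * v'.
  by move=> uv uv'; rewrite lerD// ler_wpM2l.
move=> /P3_shifted_pt[W [[A1 A2 A3 A4] [A5 A6 A7 A8]]].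
move=> /P3_shifted_pt[W' [[B1 B2 B3 B4] [B5 B6 B7 B8]]].
rewrite shifted_pt_comb; apply/P3_shifted_pt; exists (t * W + (1 - t) * W').
split; split.
- by have := comb _ _ _ _ A1 B1; lra.
- by have := comb _ _ _ _ A2 B2; lra.
- by have := comb _ _ _ _ A3 B3; lra.
- by have := comb _ _ _ _ A4 B4; lra.
- by have := comb _ _ _ _ A5 B5; lra.
- by have := comb _ _ _ _ A6 B6; lra.
- by have := comb _ _ _ _ A7 B7; lra.
- by have := comb _ _ _ _ A8 B8; lra.
Qed.

(** This is [x1 * x2 - a1 * a2]; at a corner of the square it is the only [W] that [mccormick12]
    admits. *)
Definition corner_product p q := a2 * d1 * p + a1 * d2 * q + d1 * d2 * (p * q).

(* [e] and [g] are the values of [r] on the edges [w = b1 * b2] and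
   [w = a1 * a2] of the second McCormick tetrahedron; the point divides the
   segment between them in the proportion [W : D - W]. *)
Definition P3_point W p q e g :=
  shifted_pt (W * (a3 + d3 * e)) p q (W / D * e + (1 - W / D) * g).

(** In terms of [e] and [g] the four slacks of [mccormick3] factor as [W * d3 * e],
    [W * d3 * (1 - e)], [(D - W) * d3 * g] and [(D - W) * d3 * (1 - g)]. *)
Lemma P3_point_in W p q e g : 0 <= W <= D -> mccormick12 p q W ->
  0 <= e <= 1 -> 0 <= g <= 1 -> P3 a1 b1 a2 b2 a3 b3 (P3_point W p q e g).
Proof.
move=> /andP[W0 WD] pqW /andP[e0 e1] /andP[g0 g1]; apply/P3_shifted_pt; exists W.
split=> //.
have h1 : 0 <= W * d3 * e by rewrite !mulr_ge0// ltW.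
have h2 : 0 <= W * d3 * (1 - e) by rewrite !mulr_ge0 ?(ltW d3_gt0)// subr_ge0.
have h3 : 0 <= (D - W) * d3 * g by rewrite !mulr_ge0 ?(ltW d3_gt0)// subr_ge0.
have h4 : 0 <= (D - W) * d3 * (1 - g).
  by rewrite !mulr_ge0 ?(ltW d3_gt0)// subr_ge0.
have rE : D * d3 * (W / D * e + (1 - W / D) * g) = W * d3 * e + (D - W) * d3 * g.
  by field; rewrite gt_eqF.
by rewrite /mccormick3 [D * d3 * (_ - 1)]mulrBr rE; split; lra.
Qed.

Lemma corner_product_bool (i j : bool) :
  0 <= corner_product i%:R j%:R <= D /\
  mccormick12 i%:R j%:R (corner_product i%:R j%:R).
Proof.
have h12 : 0 <= a1 * d2 by rewrite mulr_ge0// ltW.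
have h21 : 0 <= a2 * d1 by rewrite mulr_ge0// ltW.
have hdd : 0 <= d1 * d2 by rewrite mulr_ge0// ltW.
rewrite /corner_product /mccormick12.
by case: i; case: j; rewrite /= ?mulr1n ?mulr0n; (split; [apply/andP; split; lra | split; lra]).
Qed.

Lemma pt_sum4 l1 l2 l3 l4 f1 p1 q1 r1 f2 p2 q2 r2 f3 p3 q3 r3 f4 p4 q4 r4 :
  l1 + l2 + l3 + l4 = 1 ->
  \sum_(z <- [:: (l1, pt f1 p1 q1 r1); (l2, pt f2 p2 q2 r2);
                 (l3, pt f3 p3 q3 r3); (l4, pt f4 p4 q4 r4)]) z.1 *: z.2 =
  pt (l1 * f1 + l2 * f2 + l3 * f3 + l4 * f4)
    (l1 * p1 + l2 * p2 + l3 * p3 + l4 * p4)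
    (l1 * q1 + l2 * q2 + l3 * q3 + l4 * q4)
    (l1 * r1 + l2 * r2 + l3 * r3 + l4 * r4).
Proof.
move=> l_sum; have -> : l4 = 1 - l1 - l2 - l3 by rewrite -l_sum; ring.
rewrite !big_cons big_nil addr0 /pt.
by congr (_, _, _, _); rewrite /= /GRing.scale/=; ring.
Qed.

Lemma shifted_pt_sum4 l1 l2 l3 l4 F1 p1 q1 r1 F2 p2 q2 r2 F3 p3 q3 r3 F4 p4 q4 r4 :
  l1 + l2 + l3 + l4 = 1 ->
  \sum_(z <- [:: (l1, shifted_pt F1 p1 q1 r1); (l2, shifted_pt F2 p2 q2 r2);
                 (l3, shifted_pt F3 p3 q3 r3); (l4, shifted_pt F4 p4 q4 r4)]) z.1 *: z.2 =
  shifted_pt (l1 * F1 + l2 * F2 + l3 * F3 + l4 * F4)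
    (l1 * p1 + l2 * p2 + l3 * p3 + l4 * p4)
    (l1 * q1 + l2 * q2 + l3 * q3 + l4 * q4)
    (l1 * r1 + l2 * r2 + l3 * r3 + l4 * r4).
Proof.
move=> l_sum; rewrite /shifted_pt pt_sum4//; congr (pt _ _ _ _).
by have -> : l4 = 1 - l1 - l2 - l3; [rewrite -l_sum; ring|ring].
Qed.

(* The barycentric coordinates of [(p, q, W)] and of [(W, r, F)] in the two
   McCormick tetrahedra share the marginal [W]; gluing them along it splits the
   point over the corners [(i, j)] of the square, with common [e] and [g]. *)
Lemma P3_decomposition F p q r : P3 a1 b1 a2 b2 a3 b3 (shifted_pt F p q r) ->
  exists s e g, [/\ 0 <= e <= 1, 0 <= g <= 1,
    forall z, z \in s -> 0 <= z.1 /\ exists i j : bool,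
      z.2 = P3_point (corner_product i%:R j%:R) i%:R j%:R e g,
    \sum_(z <- s) z.1 = 1 & shifted_pt F p q r = \sum_(z <- s) z.1 *: z.2].
Proof.
move=> /P3_shifted_pt[W [[A1 A2 A3 A4] [A5 A6 A7 A8]]].
have dd : 0 < d1 * d2 by rewrite mulr_gt0.
have d1_neq0 : d1 != 0 by rewrite gt_eqF.
have d2_neq0 : d2 != 0 by rewrite gt_eqF.
have d3_neq0 : d3 != 0 by rewrite gt_eqF.
have D_neq0 : D != 0 by rewrite gt_eqF.
(* The barycentric coordinates are the slacks of [mccormick12] divided by [d1 * d2]. *)
pose l11 := (W - (a2 * d1 * p + a1 * d2 * q)) / (d1 * d2).
pose l10 := (b2 * d1 * p + a1 * d2 * q - W) / (d1 * d2).
pose l01 := (a2 * d1 * p + b1 * d2 * q - W) / (d1 * d2).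
pose l00 := (W - (a2 * d1 * p + a1 * d2 * q + d1 * d2 * (p + q - 1))) / (d1 * d2).
have l11_ge0 : 0 <= l11 by rewrite divr_ge0 ?subr_ge0// ltW.
have l10_ge0 : 0 <= l10 by rewrite divr_ge0 ?subr_ge0// ltW.
have l01_ge0 : 0 <= l01 by rewrite divr_ge0 ?subr_ge0// ltW.
have l00_ge0 : 0 <= l00 by rewrite divr_ge0 ?subr_ge0// ltW.
have l_sum : l00 + l01 + l10 + l11 = 1.
  by rewrite /l00 /l01 /l10 /l11; field; rewrite ?d1_neq0 ?d2_neq0.
have pE : p = l10 + l11 by rewrite /l10 /l11; field; rewrite ?d1_neq0 ?d2_neq0.
have qE : q = l01 + l11 by rewrite /l01 /l11; field; rewrite ?d1_neq0 ?d2_neq0.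
have WE : W = l10 * (a2 * d1) + l01 * (a1 * d2) + l11 * D.
  by rewrite /l10 /l01 /l11; field; rewrite ?d1_neq0 ?d2_neq0.
clearbody l00 l01 l10 l11.
have h12 : 0 <= a1 * d2 by rewrite mulr_ge0// ltW.
have h21 : 0 <= a2 * d1 by rewrite mulr_ge0// ltW.
have W_ge0 : 0 <= W.
  rewrite WE; apply: addr_ge0; last by rewrite mulr_ge0// ltW.
  by apply: addr_ge0; exact: mulr_ge0.
have W_leD : W <= D.
  rewrite WE -[leRHS]mul1r -l_sum.
  have m1 : 0 <= l10 * (D - a2 * d1) by rewrite mulr_ge0//; lra.
  have m2 : 0 <= l01 * (D - a1 * d2) by rewrite mulr_ge0//; lra.
  have m3 : 0 <= l00 * D by rewrite mulr_ge0// ltW.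
  lra.
(* [e] locates [F] between [a3 * W] and [b3 * W]. If [W = 0] then [F = 0] and any [e] serves. *)
have [e e01 FE] : exists2 e, 0 <= e <= 1 & F = W * (a3 + d3 * e).
  have [W0|W_neq0] := eqVneq W 0.
    by exists 0; rewrite ?lexx ?ler01//; move: A5 A6; rewrite W0; lra.
  have dW : 0 < d3 * W by rewrite mulr_gt0// lt_neqAle eq_sym W_neq0.
  exists ((F - a3 * W) / (d3 * W)); last by field; rewrite ?d3_neq0 ?W_neq0.
  by rewrite divr_ge0 ?subr_ge0 ?(ltW dW)//= ler_pdivrMr// mul1r; lra.
(* [g] comes from the other two inequalities in the same way. If [W = D] they force [r = e], and any
   [g] serves. *)
have [g g01 rE] : exists2 g, 0 <= g <= 1 & D * r = W * e + (D - W) * g.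
  have [WD|W_neqD] := eqVneq W D.
    exists 0; rewrite ?lexx ?ler01// mulr0 addr0.
    apply: (mulfI d3_neq0); move: A7 A8; rewrite FE WD; lra.
  have DW : 0 < d3 * (D - W) by rewrite mulr_gt0// subr_gt0 lt_neqAle W_neqD.
  have DW_neq0 : D - W != 0 by rewrite subr_eq0 eq_sym.
  exists ((d3 * (D * r - W * e)) / (d3 * (D - W))).
    rewrite ler_pdivlMr// ler_pdivrMr// mul0r mul1r.
    by apply/andP; split; move: A7 A8; rewrite FE; lra.
  by field; rewrite ?d3_neq0 ?DW_neq0.
have corner00 : corner_product 0 0 = 0 by rewrite /corner_product; ring.
have corner01 : corner_product 0 1 = a1 * d2 by rewrite /corner_product; ring.
have corner10 : corner_product 1 0 = a2 * d1 by rewrite /corner_product; ring.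
have corner11 : corner_product 1 1 = D by rewrite /corner_product; ring.
pose v i j := P3_point (corner_product i j) i j e g.
exists [:: (l00, v 0 0); (l01, v 0 1); (l10, v 1 0); (l11, v 1 1)], e, g.
split=> //.
- move=> z; rewrite !inE => /or4P[] /eqP-> /=; split=> //.
  + by exists false, false.
  + by exists false, true.
  + by exists true, false.
  + by exists true, true.
- by rewrite !big_cons big_nil addr0 !addrA.
rewrite /v /P3_point shifted_pt_sum4// corner00 corner01 corner10 corner11.
congr (shifted_pt _ _ _ _).
- by rewrite FE [in LHS]WE; ring.
- by rewrite [LHS]pE; ring.
- by rewrite [LHS]qE; ring.
- apply: (mulfI D_neq0); rewrite rE [in LHS]WE.
  have -> : l00 = 1 - l01 - l10 - l11 by rewrite -l_sum; ring.
  by field.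
Qed.

(** For fixed [W], [p], [q] the point is affine in [(e, g)], so the weights of [(e, g)] in the unit
    square carry over to the parallelogram. *)
Lemma P3_point_split W p q e g : 0 <= e <= 1 -> 0 <= g <= 1 ->
  exists s, [/\ forall z, z \in s -> 0 <= z.1 /\
      exists i j : bool, z.2 = P3_point W p q i%:R j%:R,
    \sum_(z <- s) z.1 = 1 & P3_point W p q e g = \sum_(z <- s) z.1 *: z.2].
Proof.
move=> /andP[e0 e1] /andP[g0 g1]; pose v i j := P3_point W p q i j.
exists [:: ((1 - e) * (1 - g), v 0 0); ((1 - e) * g, v 0 1);
  (e * (1 - g), v 1 0); (e * g, v 1 1)]; split.
- move=> z; rewrite !inE => /or4P[] /eqP-> /=;
    split; rewrite ?mulr_ge0 ?subr_ge0//.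
  + by exists false, false.
  + by exists false, true.
  + by exists true, false.
  + by exists true, true.
- by rewrite !big_cons big_nil /=; ring.
rewrite /v /P3_point shifted_pt_sum4; last by ring.
by congr (shifted_pt _ _ _ _); ring.
Qed.

Definition P3_vertex p q i j := P3_point (corner_product p q) p q i j.

(** [extreme_points_sum] is used twice: it selects a corner of the square, then a corner of the
    parallelogram over it. *)
Lemma extreme_P3_vertex z : extreme_points (P3 a1 b1 a2 b2 a3 b3) z ->
  exists p q i j : bool, z = P3_vertex p%:R q%:R i%:R j%:R.
Proof.
have [F [p [q [r ->]]]] := shifted_pt_surj z => extz.
have [s [e [g [e01 g01 sP s1 zE]]]] := P3_decomposition extz.1.
have [|[l z'] /sP[_ [p' [q' /= ->]]] zE'] := extreme_points_sum convex_P3 extz _ s1 zE.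
  move=> z0 /sP[l0 [i [j ->]]]; split=> //.
  by have [? ?] := corner_product_bool i j; exact: P3_point_in.
rewrite zE' in extz *.
have [s' [s'P s'1 zE'']] := P3_point_split (corner_product p'%:R q'%:R) p'%:R q'%:R e01 g01.
have [|[l' z''] /s'P[_ [i [j /= ->]]] ->] := extreme_points_sum convex_P3 extz _ s'1 zE''.
  move=> z0 /s'P[l0 [i [j ->]]]; split=> //.
  have [? ?] := corner_product_bool p' q'.
  by apply: P3_point_in => //; [case: i|case: j]; rewrite /= ?lexx ler01.
by exists p', q', i, j.
Qed.

Lemma mccormick12_bounds p q W : mccormick12 p q W -> 0 <= p <= 1 /\ 0 <= q <= 1.
Proof.
move=> [A1 A2 A3 A4]; have dd := mulr_gt0 d1_gt0 d2_gt0.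
by split; apply/andP; split; rewrite -(ler_pM2l dd); lra.
Qed.

Lemma mccormick12_bool (i j : bool) W : mccormick12 i%:R j%:R W ->
  W = corner_product i%:R j%:R.
Proof.
rewrite /mccormick12 /corner_product => -[A1 A2 A3 A4].
by apply/le_anti/andP; case: i j A1 A2 A3 A4 => -[]; rewrite /= ?mulr1n ?mulr0n; split; lra.
Qed.

Lemma convex_comb_bool t u v (i : bool) : 0 < t < 1 -> 0 <= u <= 1 -> 0 <= v <= 1 ->
  i%:R = t * u + (1 - t) * v -> u = i%:R /\ v = i%:R.
Proof.
move=> t01 /andP[u0 u1] /andP[v0 v1]; case: i => /= tE; last first.
  by have [] := convex_comb_eq0 t01 u0 v0 (esym tE).
have [|||u_eq0 v_eq0] := @convex_comb_eq0 _ t (1 - u) (1 - v) t01; lra.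
Qed.

(** The ends of a segment through the vertex lie over the same corner, which fixes [W]. Then [i]
    tells which of the first two inequalities of [mccormick3] is tight, fixing [F], and [j] which of
    the last two, fixing [r]. *)
Lemma P3_vertex_extreme (p q i j : bool) :
  extreme_points (P3 a1 b1 a2 b2 a3 b3) (P3_vertex p%:R q%:R i%:R j%:R).
Proof.
have D_neq0 : D != 0 by rewrite gt_eqF.
have bool01 (k : bool) : 0 <= (k%:R : R) <= 1 by case: k; rewrite /= ?lexx ler01.
have [W01 Wm] := corner_product_bool p q.
split=> [|x y t]; first by apply: P3_point_in.
have [F' [p' [q' [r' ->]]]] := shifted_pt_surj x; have [F'' [p'' [q'' [r'' ->]]]] := shifted_pt_surj y.
move=> /P3_shifted_pt[W' [m12' m3']] /P3_shifted_pt[W'' [m12'' m3'']] t01 vE.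
have {vE} : P3_vertex p%:R q%:R i%:R j%:R =
    t%:num *: shifted_pt F' p' q' r' + (1 - t%:num) *: shifted_pt F'' p'' q'' r'' by [].
have {t01} : 0 < t%:num < 1 by []; move: t%:num => {}t t01.
rewrite shifted_pt_comb /P3_vertex /P3_point => /shifted_pt_inj[FE pE qE rE].
have [p'01 q'01] := mccormick12_bounds m12'.
have [p''01 q''01] := mccormick12_bounds m12''.
have [p'E p''E] := convex_comb_bool t01 p'01 p''01 pE.
have [q'E q''E] := convex_comb_bool t01 q'01 q''01 qE.
rewrite p'E q'E in m12' *; rewrite p''E q''E in m12'' *.
rewrite (mccormick12_bool m12') in m3'; rewrite (mccormick12_bool m12'') in m3''.
move: (corner_product _ _) W01 m3' m3'' FE rE => W /andP[W0 WD].
move=> [A1 A2 A3 A4] [B1 B2 B3 B4] FE rE.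
have drE : D * d3 * (W / D * i%:R + (1 - W / D) * j%:R) = W * d3 * i%:R + (D - W) * d3 * j%:R.
  by field.
suff: (F' = W * (a3 + d3 * i%:R) /\ F'' = W * (a3 + d3 * i%:R)) /\
  (D * d3 * r' = W * d3 * i%:R + (D - W) * d3 * j%:R /\
   D * d3 * r'' = W * d3 * i%:R + (D - W) * d3 * j%:R).
  rewrite -drE => -[[-> ->] []].
  have Dd : D * d3 != 0 by rewrite mulf_neq0 // gt_eqF.
  by move=> /(mulfI Dd)-> /(mulfI Dd)->.
have FF : F' = W * (a3 + d3 * i%:R) /\ F'' = W * (a3 + d3 * i%:R).
  case: i FE rE drE => /= FE rE drE.
    by have [|||? ?] := @convex_comb_eq0 _ t (b3 * W - F') (b3 * W - F'') t01; lra.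
  by have [|||? ?] := @convex_comb_eq0 _ t (F' - a3 * W) (F'' - a3 * W) t01; lra.
split=> //; case: FF => F'E F''E; rewrite F'E F''E in A3 A4 B3 B4.
have rE' : t * (D * d3 * r') + (1 - t) * (D * d3 * r'') = W * d3 * i%:R + (D - W) * d3 * j%:R.
  by rewrite -drE rE; ring.
case: j drE rE rE' => /= drE rE rE'.
  by have [|||? ?] := @convex_comb_eq0 _ t (W * (a3 + d3 * i%:R) + D * d3 - b3 * W - D * d3 * r')
    (W * (a3 + d3 * i%:R) + D * d3 - b3 * W - D * d3 * r'') t01; lra.
by have [|||? ?] := @convex_comb_eq0 _ t (a3 * W + D * d3 * r' - W * (a3 + d3 * i%:R))
    (a3 * W + D * d3 * r'' - W * (a3 + d3 * i%:R)) t01; lra.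
Qed.

(** At the corner [(0, 0)] [W] is 0 and [i] drops out; at [(1, 1)] [W] is [D] and [j] drops out.
    These corners give two points each and the other two give four each, hence the twelve listed
    ones. *)
Lemma P3_verticesE z : P3_vertices a1 b1 a2 b2 a3 b3 z <->
  exists p q i j : bool, z = P3_vertex p%:R q%:R i%:R j%:R.
Proof.
have D_neq0 : D != 0 by rewrite gt_eqF.
rewrite /P3_vertices /=; have -> : b1 * b2 - a1 * a2 = D by ring.
rewrite /P3_vertex /P3_point /shifted_pt /pt /corner_product.
have tuple4 (x1 x2 x3 x4 y1 y2 y3 y4 : R) : x1 = y1 -> x2 = y2 -> x3 = y3 -> x4 = y4 ->
  (x1, x2, x3, x4) = (y1, y2, y3, y4) :> R4 R by move=> -> -> -> ->.
split.
  case.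
    move=> [[[[[[[|]|]|]|]|]|]|] ->.
    - by exists true, false, false, false; apply: tuple4 => /=; field.
    - by exists false, false, false, false; apply: tuple4 => /=; field.
    - by exists false, false, true, true; apply: tuple4 => /=; field.
    - by exists false, true, false, false; apply: tuple4 => /=; field.
    - by exists false, true, true, true; apply: tuple4 => /=; field.
    - by exists true, true, true, true; apply: tuple4 => /=; field.
    - by exists true, true, false, false; apply: tuple4 => /=; field.
    - by exists true, false, true, true; apply: tuple4 => /=; field.
  move=> [[[|]|]|] ->.
  - by exists true, false, true, false; apply: tuple4 => /=; field.
  - by exists false, true, true, false; apply: tuple4 => /=; field.
  - by exists false, true, false, true; apply: tuple4 => /=; field.
  - by exists true, false, false, true; apply: tuple4 => /=; field.
move=> [[] [[] [[] [[] ->]]]].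
- by left; left; left; right; apply: tuple4 => /=; field.
- by left; left; left; right; apply: tuple4 => /=; field.
- by left; left; right; apply: tuple4 => /=; field.
- by left; left; right; apply: tuple4 => /=; field.
- by left; right; apply: tuple4 => /=; field.
- by right; left; left; left; apply: tuple4 => /=; field.
- by right; right; apply: tuple4 => /=; field.
- by left; left; left; left; left; left; left; left; apply: tuple4 => /=; field.
- by left; left; left; left; right; apply: tuple4 => /=; field.
- by right; left; left; right; apply: tuple4 => /=; field.
- by right; left; right; apply: tuple4 => /=; field.
- by left; left; left; left; left; right; apply: tuple4 => /=; field.
- by left; left; left; left; left; left; right; apply: tuple4 => /=; field.
- by left; left; left; left; left; left; left; right; apply: tuple4 => /=; field.
- by left; left; left; left; left; left; right; apply: tuple4 => /=; field.
- by left; left; left; left; left; left; left; right; apply: tuple4 => /=; field.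
Qed.

Lemma extreme_points_P3 :
  extreme_points (P3 a1 b1 a2 b2 a3 b3) = P3_vertices a1 b1 a2 b2 a3 b3.
Proof.
apply/seteqP; split=> z.
  by move=> /extreme_P3_vertex/P3_verticesE.
by move=> /P3_verticesE[p [q [i [j ->]]]]; exact: P3_vertex_extreme.
Qed.

End normalized.

(** * Volume of the double-McCormick relaxation *)

Ltac measurable_expr := repeat first
  [ exact: measurable_cst | exact: measurable_snd
  | exact: (measurableT_comp measurable_fst)
  | exact: (measurableT_comp measurable_snd)
  | apply: measurable_funB | apply: measurable_funD | apply: measurable_funM
  | apply: measurable_maxr ].

(** * Regions between two graphs in normalized coordinates *)

Section regions.
Variables (R : realType) (a1 d1 a2 d2 a3 d3 : R).
Hypotheses (d1_gt0 : 0 < d1) (d2_gt0 : 0 < d2) (d3_gt0 : 0 < d3).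
Local Notation b1 := (a1 + d1).
Local Notation b2 := (a2 + d2).
Local Notation b3 := (a3 + d3).
Local Notation pt := (pt a1 d1 a2 d2 a3 d3).
Implicit Types (f p q r : R) (lo hi : R -> R -> R -> R).

Definition region lo hi : set (R4 R) :=
  boxed_between a1 b1 a2 b2 a3 b3
    (fun x1 x2 x3 => lo ((x1 - a1) / d1) ((x2 - a2) / d2) ((x3 - a3) / d3))
    (fun x1 x2 x3 => hi ((x1 - a1) / d1) ((x2 - a2) / d2) ((x3 - a3) / d3)).

Lemma region_pt lo hi f p q r : region lo hi (pt f p q r) <->
  [/\ 0 <= p <= 1, 0 <= q <= 1, 0 <= r <= 1 & lo p q r <= f <= hi p q r].
Proof.
have coordK (a d x : R) : 0 < d -> (a + d * x - a) / d = x.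
  by move=> d0; rewrite addrC addKr mulrC mulKf// gt_eqF.
have coord01 (a d x : R) : 0 < d -> (a <= a + d * x <= a + d) = (0 <= x <= 1).
  by move=> d0; rewrite lerDl lerD2l pmulr_rge0// ger_pMr.
rewrite /region /boxed_between /pt /= !coordK// !coord01//.
by split=> /and4P.
Qed.

(** [H], [K] and [V] arise by integrating out [r], [p] and [q] in turn; each rescaling to the unit
    interval contributes one width. *)
Lemma Vol_region lo hi (H : R -> R -> R) (K : R -> R) (V : R) :
  measurable_fun setT (fun x : R * R * R => lo x.1.1 x.1.2 x.2) ->
  measurable_fun setT (fun x : R * R * R => hi x.1.1 x.1.2 x.2) ->
  (forall p q r, 0 <= p <= 1 -> 0 <= q <= 1 -> 0 <= r <= 1 ->
    lo p q r <= hi p q r) ->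
  (forall p q, 0 <= p <= 1 -> 0 <= q <= 1 ->
    integral01 (fun r => hi p q r - lo p q r) (H p q)) ->
  (forall q, 0 <= q <= 1 -> integral01 (H ^~ q) (K q)) ->
  integral01 K V ->
  Vol (region lo hi) = (d1 * d2 * d3 * V)%:E.
Proof.
move=> mlo mhi lohi intr intp intq.
have coord01 (a d x : R) : 0 < d -> a <= x <= a + d -> 0 <= (x - a) / d <= 1.
  by move=> d0 /andP[ax xb]; rewrite ler_pdivlMr// ler_pdivrMr// mul0r mul1r subr_ge0 ax lerBlDl.
have widthK (a d : R) : a + d - a = d by rewrite addrC addKr.
have mcoord : measurable_fun setT (fun x : R * R * R =>
    ((x.1.1 - a1) / d1, (x.1.2 - a2) / d2, (x.2 - a3) / d3)).
  have affine (g : R * R * R -> R) a d : measurable_fun setT g ->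
      measurable_fun setT (fun x => (g x - a) / d).
    by move=> mg; apply: measurable_funM => //; exact: measurable_funB.
  have m1 := measurableT_comp measurable_fst (@measurable_fst _ _ (R * R)%type R).
  have m2 := measurableT_comp measurable_snd (@measurable_fst _ _ (R * R)%type R).
  by apply: measurable_fun_pair; [apply: measurable_fun_pair|]; apply: affine.
rewrite /region Vol_between.
- transitivity (\int[lebesgue_measure]_(x2 in `[a2, b2])
    (d1 * (d3 * K ((x2 - a2) / (b2 - a2))))%:E)%E.
    apply: eq_integral => x2; rewrite inE/= in_itv/= => /coord01-/(_ d2_gt0) q01.
    rewrite widthK.
    transitivity (\int[lebesgue_measure]_(x1 in `[a1, b1])
      (d3 * H ((x1 - a1) / (b1 - a1)) ((x2 - a2) / d2))%:E)%E.
      apply: eq_integral => x1; rewrite inE/= in_itv/= => /coord01-/(_ d1_gt0) p01.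
      have := integral_affine (_ : a3 < b3) (intr _ _ p01 q01).
      by rewrite !widthK ltrDl; apply.
    have := integral_affine (_ : a1 < b1) (integral01Z d3 (intp _ q01)).
    by rewrite !widthK ltrDl; apply.
  have := integral_affine (_ : a2 < b2) (integral01Z d1 (integral01Z d3 intq)).
  rewrite !widthK ltrDl => -> //; congr (_%:E); ring.
- exact: (measurableT_comp mlo mcoord).
- exact: (measurableT_comp mhi mcoord).
- by move=> x1 x2 x3 /coord01-/(_ d1_gt0) ? /coord01-/(_ d2_gt0) ? /coord01-/(_ d3_gt0) ?;
    exact: lohi.
Qed.

(** Thanks to this, a convex set contains a region as soon as it contains the two bounding
    graphs. *)
Lemma convex_fiber (A : set (R4 R)) f f0 f1 p q r : convex_set A ->
  A (pt f0 p q r) -> A (pt f1 p q r) -> f0 <= f <= f1 -> A (pt f p q r).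
Proof.
move=> cA A0 A1 /andP[f0f ff1]; have [f01|f01] := eqVneq f0 f1.
  by rewrite (_ : f = f0)//; apply/le_anti; rewrite f0f f01 ff1.
have d_gt0 : 0 < f1 - f0 by rewrite subr_gt0 lt_neqAle f01 (le_trans f0f).
pose t := (f - f0) / (f1 - f0).
have t01 : 0 <= t <= 1.
  by rewrite /t ler_pdivlMr// ler_pdivrMr// mul0r mul1r subr_ge0 f0f lerB.
have := (convex_setP A).1 cA _ _ t t01 A1 A0; rewrite pt_comb.
have idem x : t * x + (1 - t) * x = x by ring.
have -> : t * f1 + (1 - t) * f0 = f by rewrite /t; field; rewrite gt_eqF.
by rewrite !idem.
Qed.

End regions.

(** * Positive parts *)

Section pos_facts.
Variable R : realType.
Implicit Types x y t : R.

Lemma pos_ge0 x : 0 <= pos x. Proof. by rewrite /pos le_max lexx. Qed.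

Lemma pos_ge x : x <= pos x. Proof. by rewrite /pos le_max lexx orbT. Qed.

Lemma pos_nneg x : 0 <= x -> pos x = x. Proof. exact: max_r. Qed.

Lemma pos_npos x : x <= 0 -> pos x = 0. Proof. exact: max_l. Qed.

Lemma pos_le x y : 0 <= y -> x <= y -> pos x <= y.
Proof. by move=> y0 xy; rewrite /pos ge_max y0. Qed.

Lemma ler_pos x y : x <= y -> pos x <= pos y.
Proof. by move=> xy; rewrite pos_le ?pos_ge0// (le_trans xy) ?pos_ge. Qed.

Lemma posN x : pos (- x) = pos x - x.
Proof.
by have [x0|x0] := leP 0 x; [rewrite pos_npos ?pos_nneg|rewrite pos_nneg ?pos_npos]; lra.
Qed.

Lemma pos_sqr x : pos x ^+ 2 = x * pos x.
Proof.
by have [x0|/ltW x0] := leP 0 x; [rewrite pos_nneg|rewrite pos_npos]; rewrite ?expr2//; ring.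
Qed.

Lemma posM x y : 0 <= x -> pos (x * y) = x * pos y.
Proof. by move=> x0; rewrite /pos maxr_pMr// mulr0. Qed.

Lemma pos_convex x y t : 0 <= t <= 1 ->
  pos (t * x + (1 - t) * y) <= t * pos x + (1 - t) * pos y.
Proof.
move=> /andP[t0 t1]; have t1' : 0 <= 1 - t by rewrite subr_ge0.
by apply: pos_le; [rewrite addr_ge0// mulr_ge0// pos_ge0|rewrite lerD// ler_wpM2l// pos_ge].
Qed.

End pos_facts.

(** * The double-McCormick relaxation as a region, and its volume *)

Section P3_volume.
Variables (R : realType) (a1 d1 a2 d2 a3 d3 : R).
Hypotheses (a1_ge0 : 0 <= a1) (a2_ge0 : 0 <= a2) (a3_ge0 : 0 <= a3).
Hypotheses (d1_gt0 : 0 < d1) (d2_gt0 : 0 < d2) (d3_gt0 : 0 < d3).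
Local Notation b1 := (a1 + d1).
Local Notation b2 := (a2 + d2).
Local Notation b3 := (a3 + d3).
Local Notation D := (a1 * d2 + a2 * d1 + d1 * d2).
Implicit Types (f p q r : R).

Let D_gt0 : 0 < D.
Proof. by rewrite ltr_wpDl ?mulr_gt0// addr_ge0 ?mulr_ge0 ?(ltW d1_gt0) ?(ltW d2_gt0). Qed.

(** The larger lower bound and the smaller upper bound on [W] in [mccormick12], each written with a
    single positive part. *)
Definition product_lower p q := a2 * d1 * p + a1 * d2 * q + d1 * d2 * pos (p + q - 1).
Definition product_upper p q := b2 * d1 * p + a1 * d2 * q - d1 * d2 * pos (p - q).

Definition P3_lower p q r := a1 * a2 * (a3 + d3 * r) +
  (a3 * product_lower p q + d3 * pos (product_lower p q + D * (r - 1))).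
Definition P3_upper p q r := a1 * a2 * (a3 + d3 * r) +
  (b3 * product_upper p q - d3 * pos (product_upper p q - D * r)).

Let dd_ge0 : 0 <= d1 * d2. Proof. by rewrite mulr_ge0// ltW. Qed.

Lemma mccormick12P p q W : mccormick12 a1 d1 a2 d2 p q W <->
  [/\ 0 <= p <= 1, 0 <= q <= 1 & product_lower p q <= W <= product_upper p q].
Proof.
rewrite /product_lower /product_upper; split=> [pqW|[/andP[p0 p1] /andP[q0 q1] /andP[]]].
  have [p01 q01] := mccormick12_bounds d1_gt0 d2_gt0 pqW.
  case: pqW => A1 A2 A3 A4; split=> //; apply/andP; split.
    by rewrite /pos; case: (leP 0 (p + q - 1)) => _; lra.
  by rewrite /pos; case: (leP 0 (p - q)) => _; lra.
have h1 := ler_wpM2l dd_ge0 (pos_ge (p + q - 1)).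
have h2 := ler_wpM2l dd_ge0 (pos_ge0 (p + q - 1)).
have h3 := ler_wpM2l dd_ge0 (pos_ge (p - q)).
have h4 := ler_wpM2l dd_ge0 (pos_ge0 (p - q)).
by split; lra.
Qed.

Lemma product_bounds p q : 0 <= p <= 1 -> 0 <= q <= 1 ->
  [/\ 0 <= product_lower p q, product_lower p q <= product_upper p q &
      product_upper p q <= D].
Proof.
move=> /andP[p0 p1] /andP[q0 q1].
have ad : 0 <= a2 * d1 by rewrite mulr_ge0// ltW.
have ad' : 0 <= a1 * d2 by rewrite mulr_ge0// ltW.
rewrite /product_lower /product_upper; split.
- by rewrite !addr_ge0 ?mulr_ge0 ?pos_ge0// ltW.
- suff : d1 * d2 * (pos (p + q - 1) + pos (p - q)) <= d1 * d2 * p by lra.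
  by rewrite ler_wpM2l// /pos; case: (leP 0 (p + q - 1)); case: (leP 0 (p - q)); lra.
have h1 := ler_wpM2l dd_ge0 (pos_ge (p - q)).
have h2 := ler_wpM2l dd_ge0 (pos_ge0 (p - q)).
have h3 := ler_wpM2l ad p1.
have h4 := ler_wpM2l ad' q1.
have h5 := ler_wpM2l dd_ge0 p1.
have h6 := ler_wpM2l dd_ge0 q1.
lra.
Qed.

Lemma mccormick3P W r F : 0 <= W <= D -> mccormick3 a1 d1 a2 d2 a3 d3 W r F <->
  0 <= r <= 1 /\
  a3 * W + d3 * pos (W + D * (r - 1)) <= F <= b3 * W - d3 * pos (W - D * r).
Proof.
move=> /andP[W0 WD].
have dD := mulr_gt0 d3_gt0 D_gt0.
split=> [[A1 A2 A3 A4]|[/andP[r0 r1] /andP[]]].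
  split; apply/andP; split.
  - by rewrite -(pmulr_rge0 _ dD); lra.
  - by rewrite -(ler_pM2l dD); lra.
  - by rewrite /pos; case: (leP 0 (W + D * (r - 1))) => _; lra.
  - by rewrite /pos; case: (leP 0 (W - D * r)) => _; lra.
have h1 := ler_wpM2l (ltW d3_gt0) (pos_ge (W + D * (r - 1))).
have h2 := ler_wpM2l (ltW d3_gt0) (pos_ge0 (W + D * (r - 1))).
have h3 := ler_wpM2l (ltW d3_gt0) (pos_ge (W - D * r)).
have h4 := ler_wpM2l (ltW d3_gt0) (pos_ge0 (W - D * r)).
by split; lra.
Qed.

Lemma P3_bounds_in p q r : 0 <= p <= 1 -> 0 <= q <= 1 -> 0 <= r <= 1 ->
  P3 a1 b1 a2 b2 a3 b3 (pt a1 d1 a2 d2 a3 d3 (P3_lower p q r) p q r) /\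
  P3 a1 b1 a2 b2 a3 b3 (pt a1 d1 a2 d2 a3 d3 (P3_upper p q r) p q r).
Proof.
move=> p01 q01 r01; have [L0 LU UD] := product_bounds p01 q01.
have memW (W F' : R) : product_lower p q <= W <= product_upper p q ->
    a3 * W + d3 * pos (W + D * (r - 1)) <= F' <= b3 * W - d3 * pos (W - D * r) ->
    P3 a1 b1 a2 b2 a3 b3 (shifted_pt a1 d1 a2 d2 a3 d3 F' p q r).
  move=> /[dup] Wlu /andP[lW Wu] F'lu; apply/P3_shifted_pt; exists W; split.
    exact/mccormick12P.
  by apply/mccormick3P => //; rewrite (le_trans L0)// (le_trans Wu).
have nonempty (W : R) : 0 <= W <= D ->
    a3 * W + d3 * pos (W + D * (r - 1)) <= b3 * W - d3 * pos (W - D * r).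
  move=> /andP[W0 WD]; suff: d3 * (pos (W + D * (r - 1)) + pos (W - D * r)) <= d3 * W by lra.
  rewrite ler_wpM2l ?(ltW d3_gt0)//.
  case/andP: r01 => r0 r1; have := mulr_ge0 (ltW D_gt0) r0.
  have : 0 <= D * (1 - r) by rewrite mulr_ge0 ?(ltW D_gt0) ?subr_ge0.
  by rewrite /pos; case: (leP 0 (W + D * (r - 1))); case: (leP 0 (W - D * r)); lra.
split.
  apply: (memW (product_lower p q)); first by rewrite lexx.
  by rewrite lexx nonempty// L0 (le_trans LU).
apply: (memW (product_upper p q)); first by rewrite lexx andbT.
by rewrite lexx andbT nonempty// UD andbT (le_trans L0).
Qed.

(* Both bounds of [mccormick3P] increase with [W], so the extreme values of [F]
   are reached at the extreme values of [W]; convexity fills in the rest. *)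
Lemma P3_region : P3 a1 b1 a2 b2 a3 b3 = region a1 d1 a2 d2 a3 d3 P3_lower P3_upper.
Proof.
(* [pos] is 1-Lipschitz, so the upper bound on [F] grows in [W] with slope at least
   [b3 - d3 = a3]. *)
have pos1 (x y : R) : x <= y -> d3 * (pos y - pos x) <= d3 * (y - x).
  move=> xy; rewrite ler_wpM2l ?(ltW d3_gt0)//.
  by have := ler_pos xy; rewrite /pos; case: (leP 0 x); case: (leP 0 y); lra.
apply/seteqP; split=> z; have [F [p [q [r ->]]]] := shifted_pt_surj a1 a2 a3 d1_gt0 d2_gt0 d3_gt0 z.
  move=> /P3_shifted_pt[W [/mccormick12P[p01 q01 /andP[LW WU]]]].
  have [L0 LU UD] := product_bounds p01 q01.
  have W01 : 0 <= W <= D by rewrite (le_trans L0)// (le_trans WU).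
  move=> /(mccormick3P _ _ W01)[r01 /andP[lF Fu]].
  apply/region_pt => //; split=> //; rewrite /P3_lower /P3_upper !lerD2l.
  apply/andP; split.
    apply: le_trans lF; rewrite lerD ?ler_wpM2l//; first exact: ltW.
    by apply: ler_pos; rewrite lerD2r.
  apply: (le_trans Fu).
  have := pos1 (W - D * r) (product_upper p q - D * r); rewrite lerD2r => /(_ WU).
  have := ler_wpM2l a3_ge0 WU.
  lra.
move=> /region_pt-/(_ d1_gt0 d2_gt0 d3_gt0)[p01 q01 r01 lFu].
have [low upp] := P3_bounds_in p01 q01 r01.
have cP3 := @convex_P3 R a1 d1 a2 d2 a3 d3 d1_gt0 d2_gt0 d3_gt0.
exact: (convex_fiber cP3 low upp lFu).
Qed.

Lemma integral01_fiber_P3 p q : 0 <= p <= 1 -> 0 <= q <= 1 ->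
  integral01 (fun r => P3_upper p q r - P3_lower p q r)
    (b3 * product_upper p q - a3 * product_lower p q -
     d3 / (2 * D) * (product_upper p q ^+ 2 + product_lower p q ^+ 2)).
Proof.
move=> p01 q01; have [L0 LU UD] := product_bounds p01 q01.
have D_neq0 : D != 0 by rewrite gt_eqF.
rewrite /P3_upper /P3_lower.
move: (product_lower p q) (product_upper p q) L0 LU UD => L U L0 LU UD.
have LD : L / D <= 1 by rewrite ler_pdivrMr// mul1r (le_trans LU).
have U1 : U / D <= 1 by rewrite ler_pdivrMr// mul1r.
have LD0 : 0 <= L / D by rewrite divr_ge0// ltW.
have UD0 : 0 <= U / D by rewrite divr_ge0 ?(le_trans L0 LU)// ltW.
(* As functions of [r] the bounds have kinks at [U / D] and [1 - L / D]; [posN] turns the first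
   positive part around so that it increases with [r]. *)
apply: (integral01_ext (integral01D (integral01D
  (integral01_cubic (b3 * U - a3 * L - d3 * U) (d3 * D) 0 0)
  (integral01Z (- (d3 * D)) (integral01_pos (U / D))))
  (integral01Z (- (d3 * D)) (integral01_pos (1 - L / D))))).
  move=> r /=.
  have -> : U - D * r = D * (- (r - U / D)) by field.
  have -> : L + D * (r - 1) = D * (r - (1 - L / D)) by field.
  by rewrite !(posM _ (ltW D_gt0)) posN; field.
rewrite (@pos_nneg _ (1 - U / D)) ?subr_ge0// (@pos_npos _ (- (U / D))) ?oppr_le0//.
have -> : 1 - (1 - L / D) = L / D by ring.
rewrite opprB (pos_nneg LD0) (@pos_npos _ (L / D - 1)) ?subr_le0//.
by field.
Qed.

Let k := d1 * d2.
Let n := a1 * d2.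
Let B := b2 * d1.
Let C := a2 * d1.
Let e := d3 / (2 * D).

(* With [z = pos (p - q)] and [y = pos (p - (1 - q))], the identities
   [z ^+ 2 = (p - q) * z] and its analogue for [y] turn the integrand into a
   polynomial in [p] plus constant multiples of [z], [z ^+ 2], [y], [y ^+ 2]. *)
Definition P3_section_volume q :=
  (d3 * (n * q) - 2 * e * (n * q) ^+ 2) +
  (b3 * B - a3 * C - 2 * e * (n * q) * (B + C)) / 2 - e * (B ^+ 2 + C ^+ 2) / 3 +
  (- (b3 * k) + 2 * e * k * (n * q + B * q)) * (1 - q) ^+ 2 / 2 -
  e * (k ^+ 2 - 2 * k * B) * (1 - q) ^+ 3 / 3 +
  (- (a3 * k) - 2 * e * k * (n * q + C * (1 - q))) * q ^+ 2 / 2 -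
  e * (2 * k * C + k ^+ 2) * q ^+ 3 / 3.

Lemma integral01_section_P3 q : 0 <= q <= 1 ->
  integral01 (fun p => b3 * product_upper p q - a3 * product_lower p q -
     d3 / (2 * D) * (product_upper p q ^+ 2 + product_lower p q ^+ 2))
    (P3_section_volume q).
Proof.
move=> /andP[q0 q1].
apply: (integral01_ext (integral01D (integral01D (integral01D (integral01D
  (integral01_cubic (d3 * (n * q) - 2 * e * (n * q) ^+ 2)
     (b3 * B - a3 * C - 2 * e * (n * q) * (B + C)) (- e * (B ^+ 2 + C ^+ 2)) 0)
  (integral01Z (- (b3 * k) + 2 * e * k * (n * q + B * q)) (integral01_pos q)))
  (integral01Z (- e * (k ^+ 2 - 2 * k * B)) (integral01_pos_sqr q)))
  (integral01Z (- (a3 * k) - 2 * e * k * (n * q + C * (1 - q))) (integral01_pos (1 - q))))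
  (integral01Z (- e * (2 * k * C + k ^+ 2)) (integral01_pos_sqr (1 - q))))).
  move=> p /=; rewrite /product_upper /product_lower -/e -/C -/B -/k -/n.
  have -> : p + q - 1 = p - (1 - q) by ring.
  rewrite !pos_sqr.
  have zE := pos_sqr (p - q); have yE := pos_sqr (p - (1 - q)).
  move: (pos (p - q)) (pos (p - (1 - q))) zE yE => z y zE yE.
  (* The squares are expanded until [z ^+ 2] and [y ^+ 2] stand alone, ready for [zE] and [yE]. *)
  have -> : b3 * (B * p + n * q - k * z) - a3 * (C * p + n * q + k * y) -
      e * ((B * p + n * q - k * z) ^+ 2 + (C * p + n * q + k * y) ^+ 2) =
    b3 * (B * p + n * q - k * z) - a3 * (C * p + n * q + k * y) -
      e * ((B * p + n * q) ^+ 2 - 2 * (B * p + n * q) * k * z + k ^+ 2 * z ^+ 2 +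
           (C * p + n * q) ^+ 2 + 2 * (C * p + n * q) * k * y + k ^+ 2 * y ^+ 2).
    by ring.
  by rewrite zE yE; ring.
have -> : 1 - (1 - q) = q by ring.
rewrite opprB (@pos_nneg _ (1 - q)) ?subr_ge0// (@pos_npos _ (- q)) ?oppr_le0//.
rewrite (@pos_nneg _ q)// (@pos_npos _ (q - 1)) ?subr_le0//.
rewrite /P3_section_volume; ring.
Qed.

(** The terms without [D] are arranged to match the volume of the trilinear hull in [Vol_PH]; the
    term over [D] is the excess. *)
Lemma Vol_P3 : Vol (P3 a1 b1 a2 b2 a3 b3) =
  (d1 * d2 * d3 * ((d1 * d2 * a3 + d1 * a2 * d3) / 6 + a1 * d2 * d3 / 12 +
     5 * (d1 * d2 * d3) / 24 +
     d2 * d3 * (5 * (a1 * b1 * d2) + 3 * (b1 ^+ 2 * a2 - a1 ^+ 2 * b2)) / (24 * D)))%:E.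
Proof.
rewrite P3_region; apply: Vol_region; try assumption.
- by rewrite /P3_lower /product_lower; measurable_expr.
- by rewrite /P3_upper /product_upper; measurable_expr.
- move=> p q r p01 q01 r01; have [+ _] := P3_bounds_in p01 q01 r01.
  by rewrite P3_region => /region_pt-/(_ d1_gt0 d2_gt0 d3_gt0)[_ _ _ /andP[]].
- exact: integral01_fiber_P3.
- exact: integral01_section_P3.
(* In [P3_section_volume], [z0 + z1 * q] multiplies [(1 - q) ^+ 2 / 2], [w] multiplies
   [(1 - q) ^+ 3] and [y0 + y1 * q] multiplies [q ^+ 2 / 2]; expanding gives a cubic in [q]. *)
pose z0 := - (b3 * k); pose z1 := 2 * e * k * (n + B).
pose w := - e * (k ^+ 2 - 2 * k * B) / 3.
pose y0 := - (a3 * k) - 2 * e * k * C; pose y1 := - (2 * e * k) * (n - C).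
apply: (integral01_ext (integral01_cubic
  ((b3 * B - a3 * C) / 2 - e * (B ^+ 2 + C ^+ 2) / 3 + z0 / 2 + w)
  (d3 * n - e * n * (B + C) - z0 + z1 / 2 - 3 * w)
  (- 2 * e * n ^+ 2 + z0 / 2 - z1 + 3 * w + y0 / 2)
  (z1 / 2 - w + y1 / 2 - e * (2 * k * C + k ^+ 2) / 3))).
  by move=> q; rewrite /P3_section_volume /z0 /z1 /w /y0 /y1; field.
rewrite /z0 /z1 /w /y0 /y1 /e /k /n /B /C; field.
by rewrite gt_eqF.
Qed.

End P3_volume.

(** * Volume of the trilinear hull *)

Ltac pos_simp := repeat match goal with
  | |- context [pos ?x] =>
      first [ rewrite (_ : pos x = x); last by apply: pos_nneg; lra
            | rewrite (_ : pos x = 0); last by apply: pos_npos; lra ]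
  end.

Section trilinear_hull.
Variables (R : realType) (a1 d1 a2 d2 a3 d3 : R).
Hypotheses (a1_ge0 : 0 <= a1) (a2_ge0 : 0 <= a2) (a3_ge0 : 0 <= a3).
Hypotheses (d1_gt0 : 0 < d1) (d2_gt0 : 0 < d2) (d3_gt0 : 0 < d3).
Local Notation b1 := (a1 + d1).
Local Notation b2 := (a2 + d2).
Local Notation b3 := (a3 + d3).
Local Notation PH := (PH a1 b1 a2 b2 a3 b3).
Local Notation pt := (pt a1 d1 a2 d2 a3 d3).
(** Coefficients of [p * q], [p * r], [q * r] and [p * q * r] in the trilinear product. The ordering
    hypothesis of the theorem amounts to [gamma <= beta <= alpha]. *)
Local Notation alpha := (d1 * d2 * a3).
Local Notation beta := (d1 * a2 * d3).
Local Notation gamma := (a1 * d2 * d3).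
Local Notation delta := (d1 * d2 * d3).
Hypotheses (gamma_beta : gamma <= beta) (beta_alpha : beta <= alpha).
Implicit Types (f p q r : R).

Let delta_ge0 : 0 <= delta. Proof. by rewrite !mulr_ge0// ltW. Qed.
Let gamma_ge0 : 0 <= gamma. Proof. by rewrite !mulr_ge0// ltW. Qed.
Let beta_gamma_ge0 : 0 <= beta - gamma. Proof. by rewrite subr_ge0. Qed.
Let alpha_gamma_ge0 : 0 <= alpha - gamma.
Proof. by rewrite subr_ge0 (le_trans gamma_beta). Qed.
Let beta_ge0 : 0 <= beta. Proof. exact: le_trans gamma_beta. Qed.
Let alpha_ge0 : 0 <= alpha. Proof. exact: le_trans beta_alpha. Qed.

Definition trilinear_affine p q r :=
  a1 * a2 * a3 + d1 * a2 * a3 * p + a1 * d2 * a3 * q + a1 * a2 * d3 * r.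

(* On the Kuhn triangulation of the cube, where [min(p, q) = p - pos (p - q)],
   the concave envelope of each monomial is the minimum of its variables. *)
Definition PH_upper p q r := trilinear_affine p q r +
  (alpha * (p - pos (p - q)) + beta * (r - pos (r - p)) +
   gamma * (r - pos (r - q)) + delta * (r - pos (r - (p - pos (p - q))))).

(* The lower faces project to the two corner simplices at (0,0,0) and (1,1,1)
   and to the octahedron between them, split in four around its diagonal from
   (1,0,0) to (0,1,1). *)
Definition PH_lower p q r := trilinear_affine p q r +
  (gamma * (pos (p + q + r - 1) + pos (p + q + r - 2)) +
   (beta - gamma) * pos (p + r - 1) + (alpha - gamma) * pos (p + q - 1) +
   delta * pos (p + q + r - 2)).

Definition trilinear p q r := (a1 + d1 * p) * (a2 + d2 * q) * (a3 + d3 * r).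

Lemma PH_vertex (i j k : bool) : PH (pt (trilinear i%:R j%:R k%:R) i%:R j%:R k%:R).
Proof.
apply: sub_convex_hull.
exists (a1 + d1 * i%:R), (a2 + d2 * j%:R), (a3 + d3 * k%:R).
split=> //; [case: i|case: j|case: k]; rewrite /= ?mulr1 ?mulr0 ?addr0; by [left|right].
Qed.

(** Certifies membership in the hull on one cell of a triangulation, given four vertices of the cube
    and barycentric weights. *)
Lemma PH_simplex (i1 j1 k1 i2 j2 k2 i3 j3 k3 i4 j4 k4 : bool) (l1 l2 l3 l4 : R) f p q r :
  0 <= l1 -> 0 <= l2 -> 0 <= l3 -> 0 <= l4 -> l1 + l2 + l3 + l4 = 1 ->
  p = l1 * i1%:R + l2 * i2%:R + l3 * i3%:R + l4 * i4%:R ->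
  q = l1 * j1%:R + l2 * j2%:R + l3 * j3%:R + l4 * j4%:R ->
  r = l1 * k1%:R + l2 * k2%:R + l3 * k3%:R + l4 * k4%:R ->
  f = l1 * trilinear i1%:R j1%:R k1%:R + l2 * trilinear i2%:R j2%:R k2%:R +
      l3 * trilinear i3%:R j3%:R k3%:R + l4 * trilinear i4%:R j4%:R k4%:R ->
  PH (pt f p q r).
Proof.
move=> l1_ge0 l2_ge0 l3_ge0 l4_ge0 l_sum -> -> -> ->; rewrite -pt_sum4//.
apply: convex_sum.
- exact: convex_convex_hull.
- by move=> z; rewrite !inE => /or4P[] /eqP-> /=; split=> //; exact: PH_vertex.
- by rewrite !big_cons big_nil addr0 !addrA.
Qed.

(** Each ordering of [p], [q], [r] is a Kuhn simplex: its vertices form a chain from [(0,0,0)] to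
    [(1,1,1)], and the weights are successive differences. *)
Lemma PH_upper_in p q r : 0 <= p <= 1 -> 0 <= q <= 1 -> 0 <= r <= 1 ->
  PH (pt (PH_upper p q r) p q r).
Proof.
move=> /andP[p0 p1] /andP[q0 q1] /andP[r0 r1].
rewrite /PH_upper /trilinear_affine.
have [pq|qp] := leP p q.
  have [qr|rq] := leP q r.
    pos_simp; apply: (@PH_simplex false false false false false true false true true true true true
      (1 - r) (r - q) (q - p) (p));
    rewrite /trilinear /=; lra.
  have [pr|rp] := leP p r.
    pos_simp; apply: (@PH_simplex false false false false true false false true true true true true
      (1 - q) (q - r) (r - p) (p));
    rewrite /trilinear /=; lra.
  pos_simp; apply: (@PH_simplex false false false false true false true true false true true true
      (1 - q) (q - p) (p - r) (r));
    rewrite /trilinear /=; lra.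
have [pr|rp] := leP p r.
  pos_simp; apply: (@PH_simplex false false false false false true true false true true true true
      (1 - r) (r - p) (p - q) (q));
    rewrite /trilinear /=; lra.
have [qr|rq] := leP q r.
  pos_simp; apply: (@PH_simplex false false false true false false true false true true true true
      (1 - p) (p - r) (r - q) (q));
    rewrite /trilinear /=; lra.
pos_simp; apply: (@PH_simplex false false false true false false true true false true true true
      (1 - p) (p - q) (q - r) (r));
    rewrite /trilinear /=; lra.
Qed.

(** The planes [p + q = 1] and [p + r = 1] meet in the diagonal of the octahedron and cut it into
    the four tetrahedra. *)
Lemma PH_lower_in p q r : 0 <= p <= 1 -> 0 <= q <= 1 -> 0 <= r <= 1 ->
  PH (pt (PH_lower p q r) p q r).
Proof.
move=> /andP[p0 p1] /andP[q0 q1] /andP[r0 r1].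
rewrite /PH_lower /trilinear_affine.
have [s1|s1] := leP (p + q + r) 1.
  pos_simp; apply: (@PH_simplex false false false true false false false true false false false true
      (1 - p - q - r) (p) (q) (r));
    rewrite /trilinear /=; lra.
have [s2|s2] := leP 2 (p + q + r).
  pos_simp; apply: (@PH_simplex true true false true false true false true true true true true
      (1 - r) (1 - q) (1 - p) (p + q + r - 2));
    rewrite /trilinear /=; lra.
have [pq|pq] := leP (p + q) 1; have [pr|pr] := leP (p + r) 1.
- pos_simp; apply: (@PH_simplex true false false false true true false true false false false true
      (p) (p + q + r - 1) (1 - p - r) (1 - p - q));
    rewrite /trilinear /=; lra.
- pos_simp; apply: (@PH_simplex true false false false true true false false true true false true
      (1 - r) (q) (1 - p - q) (p + r - 1));
    rewrite /trilinear /=; lra.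
- pos_simp; apply: (@PH_simplex true false false false true true false true false true true false
      (1 - q) (r) (1 - p - r) (p + q - 1));
    rewrite /trilinear /=; lra.
- pos_simp; apply: (@PH_simplex true false false false true true true false true true true false
      (2 - p - q - r) (1 - p) (p + r - 1) (p + q - 1));
    rewrite /trilinear /=; lra.
Qed.


Lemma PH_vertex_bounds (i j k : bool) :
  PH_lower i%:R j%:R k%:R <= trilinear i%:R j%:R k%:R <= PH_upper i%:R j%:R k%:R.
Proof.
rewrite /PH_lower /PH_upper /trilinear_affine /trilinear.
by case: i; case: j; case: k; rewrite /=; pos_simp; apply/andP; split; lra.
Qed.

(** The lower bound is affine plus nonnegative multiples of positive parts of affine functions; the
    ordering enters through the signs of [beta - gamma] and [alpha - gamma]. The upper bound is
    affine minus nonnegative multiples of convex functions. *)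
Lemma PH_bounds_convex t p q r p' q' r' : 0 <= t <= 1 ->
  PH_lower (t * p + (1 - t) * p') (t * q + (1 - t) * q') (t * r + (1 - t) * r')
    <= t * PH_lower p q r + (1 - t) * PH_lower p' q' r' /\
  t * PH_upper p q r + (1 - t) * PH_upper p' q' r'
    <= PH_upper (t * p + (1 - t) * p') (t * q + (1 - t) * q') (t * r + (1 - t) * r').
Proof.
move=> t01.
have convex_at x y z : z = t * x + (1 - t) * y ->
    pos z <= t * pos x + (1 - t) * pos y by move=> ->; exact: pos_convex.
have affineE : trilinear_affine (t * p + (1 - t) * p') (t * q + (1 - t) * q')
    (t * r + (1 - t) * r') =
    t * trilinear_affine p q r + (1 - t) * trilinear_affine p' q' r'.
  by rewrite /trilinear_affine; ring.
rewrite /PH_lower /PH_upper affineE.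
have [p'' p''E] : exists p'', p'' = t * p + (1 - t) * p' by eexists.
have [q'' q''E] : exists q'', q'' = t * q + (1 - t) * q' by eexists.
have [r'' r''E] : exists r'', r'' = t * r + (1 - t) * r' by eexists.
rewrite -p''E -q''E -r''E.
move: (trilinear_affine _ _ _) (trilinear_affine _ _ _) => aff aff' {affineE}.
move: (gamma) (beta - gamma) (alpha - gamma) (delta) (alpha) (beta) gamma_ge0 beta_gamma_ge0
  alpha_gamma_ge0 delta_ge0 alpha_ge0 beta_ge0.
move=> cg cbg cag cd ca cb cg0 cbg0 cag0 cd0 ca0 cb0; split.
  have h1 : pos (p'' + q'' + r'' - 1) <=
      t * pos (p + q + r - 1) + (1 - t) * pos (p' + q' + r' - 1).
    by apply: convex_at; rewrite p''E q''E r''E; ring.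
  have h2 : pos (p'' + q'' + r'' - 2) <=
      t * pos (p + q + r - 2) + (1 - t) * pos (p' + q' + r' - 2).
    by apply: convex_at; rewrite p''E q''E r''E; ring.
  have h3 : pos (p'' + r'' - 1) <= t * pos (p + r - 1) + (1 - t) * pos (p' + r' - 1).
    by apply: convex_at; rewrite p''E r''E; ring.
  have h4 : pos (p'' + q'' - 1) <= t * pos (p + q - 1) + (1 - t) * pos (p' + q' - 1).
    by apply: convex_at; rewrite p''E q''E; ring.
  have := ler_wpM2l cg0 (lerD h1 h2).
  have := ler_wpM2l cd0 h2.
  have := ler_wpM2l cbg0 h3.
  have := ler_wpM2l cag0 h4.
  lra.
have h1 : pos (p'' - q'') <= t * pos (p - q) + (1 - t) * pos (p' - q').
  by apply: convex_at; rewrite p''E q''E; ring.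
have h2 : pos (r'' - p'') <= t * pos (r - p) + (1 - t) * pos (r' - p').
  by apply: convex_at; rewrite p''E r''E; ring.
have h3 : pos (r'' - q'') <= t * pos (r - q) + (1 - t) * pos (r' - q').
  by apply: convex_at; rewrite q''E r''E; ring.
(* The nested positive part is convex because [pos] is convex and increasing and its argument is
   convex. *)
have h4 : pos (r'' - (p'' - pos (p'' - q''))) <=
    t * pos (r - (p - pos (p - q))) + (1 - t) * pos (r' - (p' - pos (p' - q'))).
  apply: le_trans (pos_convex _ _ t01); apply: ler_pos.
  by rewrite p''E r''E -p''E; lra.
have := ler_wpM2l ca0 h1.
have := ler_wpM2l cb0 h2.
have := ler_wpM2l cg0 h3.
have := ler_wpM2l cd0 h4.
have -> : ca * (p'' - pos (p'' - q'')) = t * (ca * p) + (1 - t) * (ca * p') - ca * pos (p'' - q'').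
  by rewrite {1}p''E; ring.
have rE (c : R) : c * r'' = t * (c * r) + (1 - t) * (c * r') by rewrite r''E; ring.
have := rE cb; have := rE cg; have := rE cd.
lra.
Qed.

(** The region is convex and contains the eight generators, hence the hull. Conversely both graphs
    lie in the hull, and convexity fills the fibers. *)
Lemma PH_region : PH = region a1 d1 a2 d2 a3 d3 PH_lower PH_upper.
Proof.
apply/seteqP; split.
  apply: convex_hull_sub => [|z [x1 [x2 [x3 [x1E x2E x3E ->]]]]].
    apply/convex_setP => x y t t01.
    have [f [p [q [r ->]]]] := pt_surj a1 a2 a3 d1_gt0 d2_gt0 d3_gt0 x.
    have [f' [p' [q' [r' ->]]]] := pt_surj a1 a2 a3 d1_gt0 d2_gt0 d3_gt0 y.
    move=> /region_pt-/(_ d1_gt0 d2_gt0 d3_gt0)[p01 q01 r01 /andP[lf fu]].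
    move=> /region_pt-/(_ d1_gt0 d2_gt0 d3_gt0)[p'01 q'01 r'01 /andP[lf' fu']].
    rewrite pt_comb; apply/region_pt => //.
    have [lb ub] := PH_bounds_convex p q r p' q' r' t01.
    case/andP: t01 => t0 t1; have t1' : 0 <= 1 - t by rewrite subr_ge0.
    have comb (x1 x2 y1 y2 : R) : x1 <= y1 -> x2 <= y2 ->
        t * x1 + (1 - t) * x2 <= t * y1 + (1 - t) * y2.
      by move=> xy xy'; rewrite lerD// ler_wpM2l.
    have comb01 (x1 x2 : R) : 0 <= x1 <= 1 -> 0 <= x2 <= 1 ->
        0 <= t * x1 + (1 - t) * x2 <= 1.
      move=> /andP[x0 x1'] /andP[y0 y1]; have := comb _ _ _ _ x0 y0.
      have := comb _ _ _ _ x1' y1; rewrite !mulr0 addr0 !mulr1 [t + _]addrC subrK.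
      by move=> -> ->.
    split; rewrite ?comb01//.
    by rewrite (le_trans lb) ?comb//= (le_trans _ ub)// comb.
  have coord (a d x : R) : x = a \/ x = a + d ->
      exists2 i : bool, x = a + d * i%:R & 0 <= (i%:R : R) <= 1.
    case=> ->; [exists false|exists true]; rewrite ?mulr0 ?mulr1 ?addr0//=;
      by rewrite ?lexx ?ler01.
  have [i -> i01] := coord _ _ _ x1E; have [j -> j01] := coord _ _ _ x2E.
  have [k -> k01] := coord _ _ _ x3E.
  rewrite -[X in region _ _ _ _ _ _ _ _ X]/(pt (trilinear i%:R j%:R k%:R) i%:R j%:R k%:R).
  by apply/region_pt => //; split=> //; exact: PH_vertex_bounds.
move=> z; have [f [p [q [r ->]]]] := pt_surj a1 a2 a3 d1_gt0 d2_gt0 d3_gt0 z.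
move=> /region_pt-/(_ d1_gt0 d2_gt0 d3_gt0)[p01 q01 r01 lfu].
apply: (convex_fiber _ _ _ lfu).
- exact: convex_convex_hull.
- exact: PH_lower_in.
- exact: PH_upper_in.
Qed.

Definition PH_fiber_length p q :=
  alpha * (p - pos (p - q)) - (alpha - gamma) * pos (p - (1 - q)) +
  (beta + gamma + delta) / 2 - beta * (1 - p) ^+ 2 / 2 - gamma * (1 - q) ^+ 2 / 2 -
  delta * (1 - (p - pos (p - q))) ^+ 2 / 2 -
  gamma * ((p + q) ^+ 2 - pos (p - (1 - q)) ^+ 2) / 2 -
  (gamma + delta) * pos (p - (1 - q)) ^+ 2 / 2 - (beta - gamma) * p ^+ 2 / 2.

Lemma integral01_fiber_PH p q : 0 <= p <= 1 -> 0 <= q <= 1 ->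
  integral01 (fun r => PH_upper p q r - PH_lower p q r) (PH_fiber_length p q).
Proof.
move=> /andP[p0 p1] /andP[q0 q1]; rewrite /PH_fiber_length /PH_upper /PH_lower.
have z0 := pos_ge0 (p - q).
have z1 : 0 <= p - pos (p - q) <= 1.
  by rewrite /pos; case: (leP 0 (p - q)) => _; apply/andP; split; lra.
case/andP: z1; set m := p - pos (p - q) => m0 m1; set y := pos (p - (1 - q)).
have yE : pos (p + q - 1) = y by rewrite /y opprB addrA.
(* In [r] the kinks are [p], [q], [m] for the upper bound and [1 - p - q], [2 - p - q], [1 - p] for
   the lower one. *)
apply: (integral01_ext (integral01D (integral01D (integral01D (integral01D (integral01D
  (integral01D
  (integral01_cubic (alpha * m - (alpha - gamma) * y) (beta + gamma + delta) 0 0)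
  (integral01Z (- beta) (integral01_pos p)))
  (integral01Z (- gamma) (integral01_pos q)))
  (integral01Z (- delta) (integral01_pos m)))
  (integral01Z (- gamma) (integral01_pos (1 - p - q))))
  (integral01Z (- (gamma + delta)) (integral01_pos (2 - p - q))))
  (integral01Z (- (beta - gamma)) (integral01_pos (1 - p))))).
  move=> r /=; rewrite yE.
  have -> : r - (1 - p - q) = p + q + r - 1 by ring.
  have -> : r - (2 - p - q) = p + q + r - 2 by ring.
  have -> : r - (1 - p) = p + r - 1 by ring.
  by ring.
have -> : 1 - (2 - p - q) = p + q - 1 by ring.
have -> : 1 - (1 - p - q) = p + q by ring.
have -> : - (1 - p - q) = p + q - 1 by ring.
have -> : 1 - (1 - p) = p by ring.
rewrite !yE; clearbody m y; clear yE z0.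
by pos_simp; field.
Qed.

Definition PH_section_volume q :=
  (gamma * q - gamma * q ^+ 2) + (alpha + beta + delta - gamma * q) / 2 -
  (beta + delta / 2) / 3 - (alpha + delta * (1 - q)) * (1 - q) ^+ 2 / 2 +
  delta / 2 * (1 - q) ^+ 3 / 3 - (alpha - gamma) * q ^+ 2 / 2 - delta * q ^+ 3 / 6.

Lemma integral01_section_PH q : 0 <= q <= 1 ->
  integral01 (PH_fiber_length ^~ q) (PH_section_volume q).
Proof.
move=> /andP[q0 q1].
apply: (integral01_ext (integral01D (integral01D (integral01D (integral01D
  (integral01_cubic (gamma * q - gamma * q ^+ 2) (alpha + beta + delta - gamma * q)
     (- (beta + delta / 2)) 0)
  (integral01Z (- (alpha + delta * (1 - q))) (integral01_pos q)))
  (integral01Z (delta / 2) (integral01_pos_sqr q)))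
  (integral01Z (- (alpha - gamma)) (integral01_pos (1 - q))))
  (integral01Z (- (delta / 2)) (integral01_pos_sqr (1 - q))))).
  move=> p /=; rewrite /PH_fiber_length; have zE := pos_sqr (p - q).
  move: (pos (p - q)) (pos (p - (1 - q))) zE => z y zE.
  (* Arranged so that [(p - q) * z] becomes [z ^+ 2], leaving [z] and [z ^+ 2] with coefficients
     independent of [p]. *)
  have -> : (1 - (p - z)) ^+ 2 = (1 - p) ^+ 2 + 2 * (1 - q) * z - 2 * ((p - q) * z) + z ^+ 2.
    by ring.
  by rewrite -zE; field.
have -> : 1 - (1 - q) = q by ring.
rewrite /PH_section_volume; move: (alpha) (beta) (gamma) (delta) => *.
by pos_simp; field.
Qed.

Lemma Vol_PH : Vol PH =
  (delta * ((alpha + beta) / 6 + gamma / 12 + 5 * delta / 24))%:E.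
Proof.
rewrite PH_region; apply: Vol_region; try assumption.
- by rewrite /PH_lower /trilinear_affine; measurable_expr.
- by rewrite /PH_upper /trilinear_affine; measurable_expr.
- move=> p q r p01 q01 r01; have := PH_lower_in p01 q01 r01.
  by rewrite PH_region => /region_pt-/(_ d1_gt0 d2_gt0 d3_gt0)[_ _ _ /andP[]].
- exact: integral01_fiber_PH.
- exact: integral01_section_PH.
apply: (integral01_ext (integral01_cubic (beta / 6) (gamma / 2 + alpha + delta)
  (- (gamma / 2 + alpha + delta)) (delta / 6))).
  by move=> q; rewrite /PH_section_volume; field.
by field.
Qed.

End trilinear_hull.

Theorem theorem4p4 (R : realType) (a1 b1 a2 b2 a3 b3 : R)
    (h1 : 0 <= a1 < b1) (h2 : 0 <= a2 < b2) (h3 : 0 <= a3 < b3)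
    (hord : a1 * b2 * b3 + b1 * a2 * a3 <= b1 * a2 * b3 + a1 * b2 * a3
              <= b1 * b2 * a3 + a1 * a2 * b3) :
  extreme_points (P3 a1 b1 a2 b2 a3 b3) = P3_vertices a1 b1 a2 b2 a3 b3 /\
  (Vol (P3 a1 b1 a2 b2 a3 b3) =
   Vol (PH a1 b1 a2 b2 a3 b3) +
   ((b1 - a1) * (b2 - a2) ^+ 2 * (b3 - a3) ^+ 2 *
    (5 * (a1 * b1 * b2 - a1 * b1 * a2) + 3 * (b1 ^+ 2 * a2 - a1 ^+ 2 * b2)) /
    (24 * (b1 * b2 - a1 * a2)))%:E)%E.
Proof.
case/andP: h1 => a1_ge0; case/andP: h2 => a2_ge0; case/andP: h3 => a3_ge0.
(* The upper endpoints are replaced by widths, the parameters of the preceding sections. *)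
move: hord; have bE (a b : R) : b = a + (b - a) by ring.
rewrite (bE a1 b1) (bE a2 b2) (bE a3 b3).
move: (b1 - a1) (b2 - a2) (b3 - a3) => d1 d2 d3 /andP[ord1 ord2].
rewrite !ltrDl => d1_gt0 d2_gt0 d3_gt0.
have D_neq0 : a1 * d2 + a2 * d1 + d1 * d2 != 0.
  by rewrite gt_eqF// ltr_wpDl ?mulr_gt0// addr_ge0 ?mulr_ge0// ltW.
split; first exact: extreme_points_P3.
(* The two side goals are [gamma <= beta] and [beta <= alpha], the ordering hypothesis after
   cancellation. *)
rewrite Vol_P3// Vol_PH//; [|lra|lra].
rewrite -EFinD; congr (_%:E).
have -> : (a1 + d1) * (a2 + d2) - a1 * a2 = a1 * d2 + a2 * d1 + d1 * d2 by ring.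
by field.
Qed.
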